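(* Let $\beta\in(0,1)$, $x_0\in\mathbb{R}$, $0<\gamma\le1$, $p>\frac1\beta$ and $q=\frac{p}{p-1}$. Suppose $f:(0,+\infty)\times\mathbb{R}\to\mathbb{R}$ is a continuous function, and there exist nonnegative functions $l(t)$ and $k(t)$ such that $$|f(t,x)|\le l(t)|x|^{\gamma}+k(t)$$ for all $(t,x)\in(0,+\infty)\times\mathbb{R}$, where $t^{(1-\gamma)(1-\beta)}l(t)\in C(0,+\infty)\cap L^{p}_{Loc}[0,+\infty)$ and $t^{1-\beta}k(t)\in C(0,+\infty)\cap L^{p}_{Loc}[0,+\infty)$. Then the fractional differential equation $$D_{r}^{\beta}x(t)=f(t,x(t)),\qquad \lim_{t\to0^{+}}t^{1-\beta}x(t)=x_{0},$$ has at least one solution in $C_{1-\beta}(0,+\infty)$.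
   Context: $L^{p}_{Loc}[0,+\infty)$ denotes the functions belonging to $L^p[0,T]$ for every $T>0$. For $\alpha\in(0,1)$, $C_{\alpha}(0,+\infty)$ is the set of $x\in C(0,+\infty)$ such that $\lim_{t\to0^{+}}t^{\alpha}x(t)$ exists (as a finite real number). For $\beta\in(0,1)$, the Riemann-Liouville fractional integral is $I^{\beta}\varphi(t)=\frac{1}{\Gamma(\beta)}\int_{0}^{t}\frac{\varphi(s)}{(t-s)^{1-\beta}}\,ds$ for $\varphi\in L^1[0,T]$, and the Riemann-Liouville fractional derivative is $D_{r}^{\beta}\varphi(t)=\frac{d}{dt}I^{1-\beta}\varphi(t)=\frac{1}{\Gamma(1-\beta)}\frac{d}{dt}\int_{0}^{t}\frac{\varphi(s)}{(t-s)^{\beta}}\,ds$ for a.e. $t\in[0,T]$, where $I^{1-\beta}\varphi$ is required to be an absolutely continuous function (i.e. it agrees on $(0,T]$ with an absolutely continuous function on $[0,T]$). A solution in $C_{1-\beta}(0,+\infty)$ is a function $x\in C_{1-\beta}(0,+\infty)$ such that, for every $T>0$, $I^{1-\beta}x$ is absolutely continuous on $[0,T]$ in this sense and $D_r^\beta x(t)=f(t,x(t))$ for a.e. $t\in(0,T]$, and such that $\lim_{t\to0^+}t^{1-\beta}x(t)=x_0$. *)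

(* Defs.v *)
From HB Require Import structures.
From mathcomp Require Import all_boot all_order all_algebra.
From mathcomp Require Import all_classical all_reals all_analysis.
Set Implicit Arguments.
Unset Strict Implicit.
Unset Printing Implicit Defensive.
Import Order.TTheory GRing.Theory Num.Theory.
Import numFieldNormedType.Exports.
Local Open Scope classical_set_scope.
Local Open Scope ring_scope.

(* Functions on (0, +oo) are represented by total functions R -> R of which
   only the values at positive arguments are ever constrained; the value at 0
   enters some integrals over [0, T], where it is immaterial. *)

Definition Gamma (R : realType) (a : R) : R :=
  \int[lebesgue_measure]_(t in `]0, +oo[) (t `^ (a - 1) * expR (- t)).

Definition continuous_pos (R : realType) (g : R -> R) : Prop :=
  {within `]0, +oo[, continuous g}.

(* [g \_ `[0, T]] is g extended by 0 outside [0, T]. *)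
Definition Lp_loc (R : realType) (p : R) (g : R -> R) : Prop :=
  forall T : R, 0 < T -> g \_ `[0, T] \in Lfun (@lebesgue_measure R) p%:E.

Definition C_weighted (R : realType) (a : R) (x : R -> R) : Prop :=
  continuous_pos x /\ exists c : R, t `^ a * x t @[t --> 0^'+] --> c.

Definition abs_cont (R : realType) (a b : R) (g : R -> R) : Prop :=
  forall e : R, 0 < e -> exists2 d : R, 0 < d &
    forall (n : nat) (u v : 'I_n -> R),
      (forall i, [/\ a <= u i, u i <= v i & v i <= b]) ->
      trivIset [set: 'I_n] (fun i => `]u i, v i[%classic) ->
      \sum_(i < n) (v i - u i) < d ->
      \sum_(i < n) `|g (v i) - g (u i)| < e.

(* Meaningful when the integrand is integrable on [0, t], which is the case for
   [RL_integral (1 - b) x t] with 0 < t and x in [C_weighted (1 - b)]. *)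
Definition RL_integral (R : realType) (b : R) (phi : R -> R) (t : R) : R :=
  (Gamma b)^-1 *
  \int[lebesgue_measure]_(s in `[0, t]) (phi s / (t - s) `^ (1 - b)).

Definition RL_derive (R : realType) (b : R) (phi : R -> R) : R -> R :=
  derive1 (RL_integral (1 - b) phi).

Definition RL_abs_cont (R : realType) (b : R) (phi : R -> R) (T : R) : Prop :=
  exists2 F : R -> R, abs_cont 0 T F &
    {in `]0, T], RL_integral (1 - b) phi =1 F}.

(* [derive1] has a default value where the derivative does not exist, hence the
   derivability conjunct. *)
Definition RL_solution (R : realType) (b x0 : R) (f : R * R -> R)
    (x : R -> R) : Prop :=
  [/\ C_weighted (1 - b) x,
      forall T : R, 0 < T ->
        RL_abs_cont b x T /\
        {ae @lebesgue_measure R, forall t, t \in `]0, T] ->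
          derivable (RL_integral (1 - b) x) t 1 /\
          RL_derive b x t = f (t, x t)} &
      t `^ (1 - b) * x t @[t --> 0^'+] --> x0].

(* Main.v *)
(* Put b = 1 - beta and y(t) = t^b x(t).  The problem becomes the Volterra
   equation y(t) = x0 + int_0^t K(t,s) g(s,y(s)) ds with the kernel
   K(t,s) = (t / ((t-s) s))^b and g(s,y) = c s^b f(s, s^(-b) y), where
   |g(s,y)| <= m(s) (1 + |y|) for some m in L^p_loc.  By Young's inequality
   int_u^t K(t,s) m(s) ds is small, uniformly for t <= T, when t - u is small
   (this is where p > 1/beta enters).  As K decreases in t, this single estimate
   gives a bound on the weighted norm sup |y(t)| e^(-lam t) and equicontinuity for
   the Tonelli approximations, in which y(s) is replaced by y(s - h).  A
   subsequence converges pointwise by Tychonoff's theorem and equicontinuity, and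
   dominated convergence identifies the limit as a solution.  Finally Fubini's
   theorem and the value of the Beta integral give
   I^b x(t) = const + int_0^t f(s,x(s)) ds.  Taking c = Gamma(b) / B, with B the
   Beta integral, makes the identity B = Gamma(beta) Gamma(1-beta) unnecessary. *)

Require Import Defs.
From HB Require Import structures.
From mathcomp Require Import all_boot all_order all_algebra.
From mathcomp Require Import all_classical all_reals all_analysis.
From mathcomp Require Import measurable_realfun ring lra.
Set Implicit Arguments.
Unset Strict Implicit.
Unset Printing Implicit Defensive.
Import Order.TTheory GRing.Theory Num.Theory.
Import numFieldNormedType.Exports.
Local Open Scope classical_set_scope.
Local Open Scope ring_scope.

(** * Affine change of variables and powers *)

(** As [f] is only continuous, there is no contraction to iterate and the solution comes from
    compactness. The kernel is singular at both ends of ]0,t[, at s = 0 because of the weight and at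
    s = t because of the fractional order, while [m] is merely in L^p_loc; with q conjugate to p,
    the condition p > 1/beta says exactly that both powers, raised to q, remain integrable.
    Monotonicity in t matters near the diagonal: there the difference of two kernels need not be
    small, but it lies between 0 and K(t1,s), to which the smallness estimate applies again. The
    approximations live on the whole real line and equal x0 for t <= 0, so that the delay s - h and
    the start at 0 need no separate treatment. On the way back to the differential equation, the two
    exponents in the Beta integrand add up to -1, hence its integral does not depend on the
    interval; this is why the initial datum contributes only a constant, which differentiation
    removes. *)

Section affine.
Context {R : realType}.
Local Notation mu := (@lebesgue_measure R).
Local Open Scope ereal_scope.

Definition affine (r d : R) : R -> measurableTypeR R := fun x => (r * x + d)%R.

Lemma measurable_affine (r d : R) : measurable_fun setT (affine r d).
Proof. exact: measurable_funD. Qed.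

Definition affine_measure (r d : R) (r0 : (0 < r)%R) :
    {measure set (measurableTypeR R) -> \bar R} :=
  mscale (NngNum (ltW r0))
    (measure_function_pushforward__canonical__measure_function_Measure
       mu (measurable_affine r d)).

Lemma preimage_affine_itvoc (r d a b : R) : (0 < r)%R ->
  affine r d @^-1` `]a, b] = `]((a - d) / r)%R, ((b - d) / r)%R]%classic.
Proof.
move=> r0; apply/seteqP; split => x /=;
  rewrite /affine !in_itv/= ltr_pdivrMr// ler_pdivlMr//;
  by move=> /andP[h1 h2]; apply/andP; split; lra.
Qed.

(** Lebesgue measure is the only measure giving half-open intervals their length, and the factor [r]
    corrects the division of lengths by [r] in the pushforward. *)
Lemma lebesgue_measure_affine (r d : R) (r0 : (0 < r)%R) (A : set R) : measurable A ->
  affine_measure d r0 A = mu A.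
Proof.
move=> mA; apply/esym; apply: lebesgue_measure_unique => //= _ [[a b]] _ <-.
rewrite /affine_measure/= /mscale/= /pushforward/= preimage_affine_itvoc//.
rewrite !lebesgue_measure_itv/= !lte_fin ltr_pM2r ?invr_gt0// ltrD2r.
case: ifPn => ab; last by rewrite mule0.
rewrite -!EFinB -EFinM; congr EFin.
by field; rewrite gt_eqF.
Qed.

Lemma ge0_integral_affine (r d : R) (D : set R) (h : R -> \bar R) : (0 < r)%R ->
  measurable D -> measurable_fun D h -> (forall x, D x -> 0 <= h x) ->
  \int[mu]_(x in D) h x =
  r%:E * \int[mu]_(x in affine r d @^-1` D) h (affine r d x).
Proof.
move=> r0 mD mh h0.
rewrite -(@ge0_integral_pushforward _ _ (measurableTypeR R)
  (measurableTypeR R) R _ (measurable_affine r d) mu D h)//;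
  last by move=> x /set_mem; exact: h0.
transitivity (\int[affine_measure d r0]_(x in D) h x).
  by apply: eq_measure_integral => A mA _; exact/esym/lebesgue_measure_affine.
by rewrite (@ge0_integral_mscale _ (measurableTypeR R)).
Qed.

Lemma ge0_integral_opp (D : set R) (h : R -> \bar R) :
  measurable D -> measurable_fun D h -> (forall x, D x -> 0 <= h x) ->
  \int[mu]_(x in D) h x = \int[mu]_(x in -%R @^-1` D) h (- x)%R.
Proof.
move=> mD mh h0.
have mN : measurable_fun setT (-%R : measurableTypeR R -> measurableTypeR R).
  exact: oppr_measurable.
rewrite -(@ge0_integral_pushforward _ _ (measurableTypeR R)
  (measurableTypeR R) R _ mN mu D h)//; last first.
  by move=> x /set_mem; exact: h0.
apply: eq_measure_integral => A mA _; apply/esym.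
exact: lebesgue_measureN.
Qed.

Lemma preimage_reflect_itvoo (t u v : R) :
  -%R @^-1` (affine 1 t @^-1` `]u, v[) = `](t - v)%R, (t - u)%R[%classic.
Proof.
by apply/seteqP; split => x /=; rewrite /affine !in_itv/= => /andP[h1 h2];
  apply/andP; split; lra.
Qed.

Lemma ge0_integral_reflect (t u v : R) (h : R -> \bar R) :
  measurable_fun `]u, v[ h -> (forall x, (u < x < v)%R -> 0 <= h x) ->
  \int[mu]_(x in `]u, v[) h x = \int[mu]_(x in `](t - v)%R, (t - u)%R[) h (t - x)%R.
Proof.
move=> mh h0.
have mA : measurable (affine 1 t @^-1` `]u, v[%classic : set R).
  by rewrite -[X in measurable X]setTI; exact: measurable_affine.
rewrite (@ge0_integral_affine 1 t)// mul1e ge0_integral_opp//.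
- rewrite preimage_reflect_itvoo; apply: eq_integral => x _.
  by rewrite /affine mul1r addrC.
- apply: (measurable_comp (F := `]u, v[%classic)) => //.
  + by move=> _ [x /= xuv <-].
  + exact: measurable_funTS (measurable_affine 1 t).
- by move=> x /=; rewrite in_itv/=; exact: h0.
Qed.

End affine.

(** * Integrability of negative powers at the origin *)

Section power_integrable.
Context {R : realType}.
Local Notation mu := (@lebesgue_measure R).

Lemma integral_powRN_segment (a u v : R) : a < 1 -> 0 < u -> u < v ->
  (\int[mu]_(s in `[u, v]) (s `^ (- a))%:E =
   (v `^ (1 - a) / (1 - a))%:E - (u `^ (1 - a) / (1 - a))%:E)%E.
Proof.
move=> a1 u0 uv.
pose F x : R := x `^ (1 - a) / (1 - a).
have Fd (x : R) : 0 < x -> is_derive x 1 F (x `^ (- a)).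
  move=> x0; rewrite /F.
  have -> : x `^ (- a) = (1 - a)^-1 *: ((1 - a) * x `^ (1 - a - 1)).
    rewrite /GRing.scale/= mulKf; last by rewrite subr_eq0 gt_eqF.
    by congr (_ `^ _); ring.
  have -> : (fun x => x `^ (1 - a) / (1 - a)) = (1 - a)^-1 \*: (fun x : R => x `^ (1 - a)).
    by apply/funext => y; rewrite /= mulrC.
  exact: is_deriveZ (is_derive1_powR (1 - a) x0).
have cF (x : R) : 0 < x -> {for x, continuous F}.
  move=> x0; apply: differentiable_continuous; apply/derivable1_diffP.
  by have := Fd x x0; case.
have cp (x : R) : 0 < x -> {for x, continuous (fun x : R => x `^ (- a))}.
  move=> x0; apply: differentiable_continuous; apply/derivable1_diffP.
  by apply: derivable_powR; rewrite in_itv/= x0.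
rewrite (@continuous_FTC2 R _ F)//.
- apply: continuous_in_subspaceT => x; rewrite inE/= in_itv/= => /andP[ux _].
  by apply: cp; exact: lt_le_trans ux.
- split.
  + move=> x; rewrite in_itv/= => /andP[ux _].
    by have [] := Fd x (lt_trans u0 ux).
  + by apply: cvg_at_right_filter; exact: cF.
  + by apply: cvg_at_left_filter; apply: cF; exact: lt_trans uv.
- move=> x; rewrite in_itv/= => /andP[ux _].
  by have [_] := Fd x (lt_trans u0 ux); rewrite derive1E.
Qed.

(** The segments [1/(n+1), T] avoid the singularity and exhaust the domain; the integrals over them
    are bounded by T^(1-a)/(1-a), and monotone convergence carries the bound to the limit. *)
Lemma integrable_powRN (a T : R) : a < 1 ->
  mu.-integrable `]0, T[ (fun s => (s `^ (- a))%:E).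
Proof.
move=> a1.
have mp D : measurable_fun D (fun s : R => (s `^ (- a))%:E).
  by apply/measurable_EFinP; exact: measurable_funTS (measurable_powR _).
apply/integrableP; split; first exact: mp.
under eq_integral do rewrite gee0_abs ?lee_fin ?powR_ge0//.
pose F (n : nat) : set R := `[n.+1%:R^-1, T]%classic.
have Fi n : (\int[mu]_(s in F n) (s `^ (- a))%:E <= (T `^ (1 - a) / (1 - a))%:E)%E.
  have [nT|Tn] := ltP n.+1%:R^-1 T.
    rewrite integral_powRN_segment// -EFinB lee_fin lerBlDr lerDl.
    by rewrite divr_ge0 ?powR_ge0// subr_ge0 ltW.
  apply: (@le_trans _ _ 0%E); last first.
    by rewrite lee_fin divr_ge0 ?powR_ge0// subr_ge0 ltW.
  have : F n `<=` [set T].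
    move=> x; rewrite /F /= in_itv/= => /andP[h1 h2].
    by apply/eqP; rewrite eq_le h2 (le_trans Tn).
  by move=> /integral_Sset1 ->.
have FT : `]0, T[%classic `<=` \bigcup_i F i.
  move=> x; rewrite /= in_itv/= => /andP[x0 xT].
  have [n nx] : exists n, n.+1%:R^-1 < x :> R.
    by case: (near_infty_natSinv_lt (PosNum x0)) => n _ /(_ n (leqnn n)); exists n.
  by exists n => //; rewrite /F /= in_itv/= (ltW xT) andbT ltW.
apply: (@le_lt_trans _ _ (T `^ (1 - a) / (1 - a))%:E); last by rewrite ltry.
apply: (@le_trans _ _ (\int[mu]_(s in \bigcup_i F i) (s `^ (- a))%:E)%E).
  apply: ge0_subset_integral => //.
  - by apply: bigcup_measurable => k _; exact: measurable_itv.
  - exact: mp.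
  - by move=> x _; rewrite lee_fin powR_ge0.
have h := @ge0_nondecreasing_set_cvg_integral _ (measurableTypeR R) R F
  (fun s => (s `^ (- a))%:E) mu.
have {}h : (\int[mu]_(x in F i) (x `^ (- a))%:E @[i --> \oo] -->
    \int[mu]_(x in \bigcup_i F i) (x `^ (- a))%:E)%E.
  apply: h => //.
  - apply/nondecreasing_seqP => n; rewrite subsetEset; apply: subset_itvr.
    by rewrite bnd_simp lef_pV2 ?posrE// ler_nat.
  - by move=> i; exact: measurable_itv.
  - by move=> i; exact: mp.
  - by move=> i x _; rewrite lee_fin powR_ge0.
rewrite -(cvg_lim _ h)//.
apply: lime_le; first by apply/cvg_ex; eexists; exact: h.
by apply: nearW => n; exact: Fi.
Qed.

End power_integrable.

Lemma integral_abs_continuous {R : realType} (D : set R) (f : R -> R) (e : R) :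
  measurable D -> (@lebesgue_measure R).-integrable D (EFin \o f) -> 0 < e ->
  exists2 d : R, 0 < d & forall A, measurable A -> A `<=` D ->
    (lebesgue_measure A < d%:E)%E ->
    \int[lebesgue_measure]_(x in A) `|f x| < e.
Proof.
move=> mD fD e0.
have : (@lebesgue_measure R).-integrable setT (EFin \o f \_ D).
  by rewrite -restrict_EFin; apply/integrable_restrict => //=; rewrite setTI.
move=> /integral_normr_continuous /(_ _ e0)[d [d0 fd]].
exists d => // A mA AD /(fd _ mA); apply: le_lt_trans.
rewrite le_eqVlt; apply/orP; left; apply/eqP.
by apply: eq_Rintegral => x xA; rewrite patchE mem_set//; apply: AD; exact/set_mem.
Qed.

(** * The weighted Riemann-Liouville kernel *)

Section powRN_reflect.
Context {R : realType}.
Local Notation mu := (@lebesgue_measure R).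

Lemma measurable_powRN (a : R) (D : set R) :
  measurable_fun D (fun s : R => s `^ (- a)).
Proof. exact: measurable_funTS (measurable_powR _). Qed.

Lemma measurable_powRN_reflect (a t : R) (D : set R) :
  measurable_fun D (fun s : R => (t - s) `^ (- a)).
Proof.
apply: measurable_funTS.
rewrite (_ : (fun s => _) = (fun x : R => x `^ (- a)) \o (fun s : R => t - s))//.
apply: measurableT_comp; [exact: measurable_powR|exact: measurable_funB].
Qed.

Lemma integral_powRN_reflect (a u t : R) :
  (\int[mu]_(s in `]u, t[) ((t - s) `^ (- a))%:E =
   \int[mu]_(s in `]0%R, (t - u)%R[) (s `^ (- a))%:E)%E.
Proof.
rewrite [RHS](@ge0_integral_reflect _ t)/=.
- by rewrite subr0 subKr.
- by apply/measurable_EFinP; exact: measurable_powRN.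
- by move=> x _; rewrite lee_fin powR_ge0.
Qed.

Lemma integrable_powRN_reflect (a t : R) : a < 1 ->
  mu.-integrable `]0, t[ (fun s => ((t - s) `^ (- a))%:E).
Proof.
move=> a1; apply/integrableP; split.
  by apply/measurable_EFinP; exact: measurable_powRN_reflect.
under eq_integral do rewrite gee0_abs ?lee_fin ?powR_ge0//.
rewrite integral_powRN_reflect subr0.
have /integrableP[_] := integrable_powRN t a1.
by under eq_integral do rewrite gee0_abs ?lee_fin ?powR_ge0//.
Qed.

Lemma Rintegral_powRN_reflect (a u t : R) :
  \int[mu]_(s in `]u, t[) ((t - s) `^ (- a)) =
  \int[mu]_(s in `]0, t - u[) (s `^ (- a)).
Proof. by rewrite /Rintegral integral_powRN_reflect. Qed.

End powRN_reflect.

(* The kernel $t^b (t-s)^{-b} s^{-b}$ is the Riemann-Liouville kernel of order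
   $1-b$ after the substitution $y(t) = t^b x(t)$. *)
Definition wkernel {R : realType} (b t s : R) : R :=
  t `^ b * ((t - s) `^ (- b) * s `^ (- b)).

Section wkernel.
Context {R : realType}.
Variable b : R.
Hypothesis b01 : 0 < b < 1.
Local Notation mu := (@lebesgue_measure R).
Local Notation K := (wkernel b).

Let b0 : 0 < b. Proof. by case/andP: b01. Qed.
Let b1 : b < 1. Proof. by case/andP: b01. Qed.

Lemma wkernel_ge0 (t s : R) : 0 <= K t s.
Proof. by rewrite !mulr_ge0 ?powR_ge0. Qed.

Lemma measurable_wkernel (t : R) (D : set R) : measurable_fun D (K t).
Proof.
apply: measurable_funM; first exact: measurable_cst.
by apply: measurable_funM; [exact: measurable_powRN_reflect|exact: measurable_powRN].
Qed.

(** In this form [t] enters only through the ratio t/(t-s), which decreases in [t]. *)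
Lemma wkernelE (t s : R) : 0 < s < t -> K t s = (t / (t - s)) `^ b * s `^ (- b).
Proof.
move=> /andP[s0 st]; rewrite /wkernel mulrA powRM ?invr_ge0 ?subr_ge0//; first last.
- exact: ltW.
- by apply: ltW; exact: lt_trans st.
by rewrite -powR_inv1 ?subr_ge0 1?ltW// -powRrM mulN1r.
Qed.

Lemma le_wkernel (s t1 t2 : R) : 0 < s < t1 -> t1 <= t2 -> K t2 s <= K t1 s.
Proof.
move=> /andP[s0 st] t12; rewrite !wkernelE ?s0/= ?(lt_le_trans st)//.
rewrite ler_wpM2r ?powR_ge0//.
have t10 : 0 < t1 by exact: lt_trans st.
have t20 : 0 < t2 by exact: lt_le_trans t12.
have st2 : s < t2 by exact: lt_le_trans t12.
apply: ge0_ler_powR; rewrite ?nnegrE ?divr_ge0 ?subr_ge0 ?(ltW st) ?(ltW st2)//;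
  [exact: ltW..|].
rewrite ler_pdivrMr ?subr_gt0// mulrAC ler_pdivlMr ?subr_gt0//.
nra.
Qed.

(** Away from the diagonal the kernel is Lipschitz in [t] relative to its own size. Indeed K(t2,s) =
    r^b K(t1,s) with r <= 1 the quotient of the two ratios, r^b >= r because b < 1, and 1 - r = s
    (t2-t1) / ((t2-s) t1) is at most (t2-t1)/d since s <= t1 and d <= t2-s. *)
Lemma wkernelB_le (d s t1 t2 : R) : 0 < s -> 0 < d -> s <= t1 - d -> t1 <= t2 ->
  K t1 s - K t2 s <= (t2 - t1) / d * K t1 s.
Proof.
move=> s0 d0 sd t12.
have st1 : s < t1 by lra.
have st2 : s < t2 by lra.
rewrite !wkernelE ?s0//.
set A := s `^ (- b); have A0 : 0 <= A by exact: powR_ge0.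
have t1s : 0 < t1 / (t1 - s) by rewrite divr_gt0; lra.
set r := (t2 * (t1 - s)) / ((t2 - s) * t1).
have r0 : 0 < r by rewrite divr_gt0// mulr_gt0; lra.
have -> : t2 / (t2 - s) = t1 / (t1 - s) * r.
  by rewrite /r; field; rewrite !gt_eqF//; lra.
rewrite (powRM _ (ltW t1s) (ltW r0)).
have r1 : r <= 1 by rewrite /r ler_pdivrMr ?mul1r; [nra|rewrite mulr_gt0; lra].
have rb : r <= r `^ b by rewrite ger1_powR ?r0//= ltW.
have rd : 1 - (t2 - t1) / d <= r.
  rewrite /r ler_pdivlMr; last by rewrite mulr_gt0; lra.
  have h : s * d <= (t2 - s) * t1 by nra.
  have w0 : 0 <= (t2 - t1) / d by rewrite divr_ge0; lra.
  have wd : (t2 - t1) / d * d = t2 - t1 by rewrite divfK// gt_eqF.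
  have := ler_wpM2l w0 h; rewrite mulrCA wd.
  lra.
set P := (t1 / (t1 - s)) `^ b; have P0 : 0 <= P by exact: powR_ge0.
have := mulr_ge0 P0 A0; set Q := r `^ b.
have {rb rd} : 1 - (t2 - t1) / d <= Q by exact: le_trans rb.
set w := (_ / d) => wQ PA.
have : 0 <= (Q - (1 - w)) * (P * A) by rewrite mulr_ge0// subr_ge0.
nra.
Qed.

(** The larger of s and t-s is at least t/2, so t^b cancels its power up to 2^b <= 2. The product of
    two singularities is thereby replaced by their sum. *)
Lemma wkernel_le (t s : R) : 0 < s < t ->
  K t s <= 2 * (s `^ (- b) + (t - s) `^ (- b)).
Proof.
move=> /andP[s0 st].
have hb (u : R) : 0 < u -> t <= 2 * u -> t `^ b * u `^ (- b) <= 2.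
  move=> u0 tu; rewrite powRN -ler_pdivlMr ?invr_gt0 ?powR_gt0// invrK.
  apply: (@le_trans _ _ ((2 * u) `^ b)).
    have t0 : 0 <= t by rewrite ltW// (lt_trans s0).
    have u20 : 0 <= 2 * u by rewrite mulr_ge0// ltW.
    by apply: ge0_ler_powR => //; exact: ltW.
  rewrite powRM ?(ltW u0)//; apply: ler_wpM2r; first exact: powR_ge0.
  by apply: ler1_powR; [rewrite ler1n|exact: ltW].
rewrite /wkernel; have := powR_ge0 s (- b); have := powR_ge0 (t - s) (- b).
have [h|h] := leP t (2 * s).
  have := hb s s0 h; nra.
have ts : 0 < t - s by lra.
have := hb (t - s) ts; nra.
Qed.

End wkernel.
(** The third conclusion is the hypothesis in another form: q b < 1 amounts to 1 < p (1-b). It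
    places s^(-b) in L^q near 0. *)
Lemma conjugate_exponent {R : realFieldType} (b p : R) (q := p / (p - 1)) :
  0 < b < 1 -> (1 - b)^-1 < p ->
  [/\ 1 < p, 1 <= q, q * b < 1 & q^-1 + p^-1 = 1].
Proof.
move=> /andP[b0 b1] bp.
have p1 : 1 < p by apply: lt_trans bp; rewrite invf_gt1; lra.
split=> //.
- by rewrite /q ler_pdivlMr; lra.
- have : 1 < p * (1 - b) by rewrite -ltr_pdivrMr ?div1r//; lra.
  by move=> h; rewrite /q mulrAC ltr_pdivrMr; lra.
- by rewrite /q; field; rewrite !gt_eqF//; lra.
Qed.

(** * Smallness and boundedness of the kernel integrals *)

Section wkernel_estimates.
Context {R : realType}.
Variables (b p : R) (m : R -> R).
Hypothesis b01 : 0 < b < 1.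
Hypothesis bp : (1 - b)^-1 < p.
Local Notation mu := (@lebesgue_measure R).
Hypothesis m_ge0 : forall s : R, 0 < s -> 0 <= m s.
Hypothesis mm : measurable_fun (`]0, +oo[%classic : set R) m.
Hypothesis mLp : forall T : R, 0 < T -> mu.-integrable `]0, T[ (fun s => (m s `^ p)%:E).
Local Notation K := (wkernel b).

Let q := p / (p - 1).
Let a := q * b.

Let p1 : 1 < p. Proof. by have [] := conjugate_exponent b01 bp. Qed.
Let p0 : 0 < p. Proof. exact: lt_trans ltr01 p1. Qed.
Let q1 : 1 <= q. Proof. by have [] := conjugate_exponent b01 bp. Qed.
Let q0 : 0 < q. Proof. exact: lt_le_trans ltr01 q1. Qed.
Let a1 : a < 1. Proof. by have [] := conjugate_exponent b01 bp. Qed.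
Let conj : q^-1 + p^-1 = 1.
Proof. by have [] := conjugate_exponent b01 bp. Qed.

(** Young's inequality for (eta u)(v/eta), with the divisors q and p, both at least 1, dropped. The
    free parameter [eta] shifts weight between the kernel and [m]. *)
Let young (eta u v : R) : 0 < eta -> 0 <= u -> 0 <= v ->
  u * v <= eta `^ q * u `^ q + eta `^ (- p) * v `^ p.
Proof.
move=> e0 u0 v0.
have -> : u * v = (eta * u) * (eta^-1 * v) by field; rewrite gt_eqF.
have e0' := ltW e0.
have ei0 : 0 <= eta^-1 by rewrite invr_ge0.
apply: le_trans (conjugate_powR _ _ _ _ conj) _ => //.
- exact: mulr_ge0.
- exact: mulr_ge0.
have -> : eta `^ (- p) = eta^-1 `^ p by rewrite -powR_inv1// -powRrM mulN1r.
rewrite -!powRM// lerD//.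
- by rewrite ler_pdivrMr// ler_peMr ?powR_ge0.
- by rewrite ler_pdivrMr// ler_peMr ?powR_ge0// ltW.
Qed.

(** The outcome of [wkernel_le] followed by [young] for each of the two powers, which is why the [m]
    term carries 4 and not 2. *)
Let majorant (eta t s : R) := 2 * eta `^ q * (s `^ (- a) + (t - s) `^ (- a)) +
  4 * eta `^ (- p) * m s `^ p.

Let le_majorant (eta t s : R) : 0 < eta -> 0 < s < t ->
  K t s * m s <= majorant eta t s.
Proof.
move=> e0 st; have [s0 ts] := andP st.
have ts0 : 0 < t - s by rewrite subr_gt0.
have ms := m_ge0 s0.
apply: (@le_trans _ _ (2 * (s `^ (- b) + (t - s) `^ (- b)) * m s)).
  by rewrite ler_wpM2r// wkernel_le.
have pwE (u : R) : (u `^ (- b)) `^ q = u `^ (- a).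
  by rewrite -powRrM /a; congr (_ `^ _); ring.
have := young e0 (powR_ge0 s (- b)) ms.
have := young e0 (powR_ge0 (t - s) (- b)) ms.
rewrite !pwE /majorant; lra.
Qed.

Let measurable_Km t (D : set R) : D `<=` `]0, +oo[ ->
  measurable_fun D (fun s => K t s * m s).
Proof.
move=> D0; apply: measurable_funM; first exact: measurable_wkernel.
exact: measurable_funS mm.
Qed.

Let sub0T (u v T : R) : 0 <= u -> v <= T -> `]u, v[ `<=` `]0, T[.
Proof.
by move=> u0 vT; apply: subset_itv; rewrite bnd_simp.
Qed.

Let integrable_majorant (eta t : R) : 0 < t ->
  mu.-integrable `]0, t[ (EFin \o majorant eta t).
Proof.
move=> t0.
have i1 := integrable_powRN t a1.
have i2 := integrable_powRN_reflect t a1.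
have i3 := mLp t0.
have mI : measurable (`]0, t[%classic : set (measurableTypeR R)).
  exact: measurable_itv.
have i12 := integrableD mI i1 i2.
have := integrableD mI (integrableZl mI (2 * eta `^ q) i12)
  (integrableZl mI (4 * eta `^ (- p)) i3).
by apply: eq_integrable => // s _; rewrite /majorant /= EFinD !EFinM EFinD.
Qed.

Lemma integrable_wkernelM t : mu.-integrable `]0, t[ (fun s => (K t s * m s)%:E).
Proof.
have [t0|t0] := leP t 0.
  by rewrite set_itv_ge ?bnd_simp -?leNgt//; exact: integrable_set0.
apply: le_integrable (integrable_majorant 1 t0) => //.
  apply/measurable_EFinP; apply: measurable_Km => s /=.
  by rewrite !in_itv/= andbT => /andP[].
move=> s /=; rewrite in_itv/= => st; have [s0 _] := andP st.
have Km0 : 0 <= K t s * m s by apply: mulr_ge0; [exact: wkernel_ge0|exact: m_ge0].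
rewrite lee_fin (ger0_norm Km0).
by rewrite (le_trans (le_majorant ltr01 st))// ler_norm.
Qed.

(** Reflection moves the power of t-s to the origin, over an interval of the same length t-u. The
    [m] term is deliberately enlarged to ]0,T[: it then depends neither on [u] nor on [t], and [eta]
    alone controls it. *)
Let wkernelM_bound eta u t T : 0 < eta -> 0 <= u -> u <= t -> t <= T -> 0 < T ->
  \int[mu]_(s in `]u, t[) (K t s * m s) <=
  2 * eta `^ q * (\int[mu]_(s in `]u, t[) (s `^ (- a)) +
    \int[mu]_(s in `]0, t - u[) (s `^ (- a))) +
  4 * eta `^ (- p) * \int[mu]_(s in `]0, T[) (m s `^ p).
Proof.
move=> e0 u0 ut tT T0.
have [t0|t0] := leP t 0.
  have -> : `]u, t[%classic = set0 :> set R.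
    by rewrite set_itv_ge// bnd_simp -leNgt (le_trans t0).
  rewrite !Rintegral_set0 add0r addr_ge0// !mulr_ge0 ?powR_ge0//;
    by apply: Rintegral_ge0 => s _; exact: powR_ge0.
have st := sub0T u0 (lexx t).
have mI : measurable (`]u, t[%classic : set (measurableTypeR R)) by exact: measurable_itv.
have iS f : mu.-integrable `]0, t[ f -> mu.-integrable `]u, t[ f.
  by apply: integrableS => //; exact: measurable_itv.
have i1 := iS _ (integrable_powRN t a1).
have i2 := iS _ (integrable_powRN_reflect t a1).
have i3 := iS _ (mLp t0).
have i12 := integrableD mI i1 i2.
apply: (@le_trans _ _ (\int[mu]_(s in `]u, t[) majorant eta t s)).
  apply: le_Rintegral => //.
  - exact: iS (integrable_wkernelM t).
  - exact: iS (integrable_majorant eta t0).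
  - move=> s; rewrite /= in_itv/= => /andP[us s_t].
    by apply: le_majorant; rewrite ?s_t ?andbT//; exact: le_lt_trans us.
rewrite /majorant RintegralD//=; last 2 first.
  exact: (integrableZl mI (2 * eta `^ q) i12).
  exact: (integrableZl mI (4 * eta `^ (- p)) i3).
rewrite !RintegralZl//.
rewrite RintegralD// Rintegral_powRN_reflect lerD2l.
apply: ler_wpM2l; first by rewrite mulr_ge0 ?powR_ge0.
apply: fine_le.
- exact: integrable_fin_num.
- by apply: integrable_fin_num => //; exact: mLp.
- apply: ge0_subset_integral => //.
  + by case/integrableP: (mLp T0).
  + by move=> s _; rewrite lee_fin powR_ge0.
  + exact: sub0T.
Qed.

(** [eta] is fixed first, so that the [m] term is at most eps/2 on every interval; with this [eta],
    absolute continuity of the integral of s^(-a) makes the other term small on short intervals. *)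
Lemma wkernelM_small T eps : 0 < T -> 0 < eps -> exists2 d, 0 < d &
  forall u t, 0 <= u -> u <= t -> t <= T -> t - u <= d ->
  \int[mu]_(s in `]u, t[) (K t s * m s) <= eps.
Proof.
move=> T0 eps0.
set M := \int[mu]_(s in `]0, T[) (m s `^ p).
have M0 : 0 <= M by apply: Rintegral_ge0 => s _; exact: powR_ge0.
(* The value intended for eta^(-p): it gives 4 r M <= eps/2. The added 1 keeps the divisor positive
   when M = 0. *)
pose r := eps / (8 * (M + 1)).
have r0 : 0 < r by rewrite divr_gt0// mulr_gt0//; lra.
pose eta := r `^ (- p^-1).
have e0 : 0 < eta by exact: powR_gt0.
have etap : eta `^ (- p) = r.
  rewrite /eta -powRrM mulrNN mulVf ?powRr1//; first exact: ltW.
  by rewrite gt_eqF.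
have eq0 : 0 < eta `^ q by exact: powR_gt0.
(* The bound wanted for each of the two power integrals: 2 eta^q times their sum is then at most
   eps/2. *)
have z0 : 0 < eps / (8 * eta `^ q) by rewrite divr_gt0// mulr_gt0.
have [d d0 hd] := integral_abs_continuous (measurable_itv _)
  (integrable_powRN T a1) z0.
(* Halving [d] turns the strict bound on the measure into a closed condition on the length. *)
have {}hd (u v : R) : 0 <= u -> u <= v -> v <= T -> v - u <= d / 2 ->
    \int[mu]_(s in `]u, v[) (s `^ (- a)) <= eps / (8 * eta `^ q).
  move=> u0 uv vT vud; apply: ltW.
  have : \int[mu]_(s in `]u, v[) `|s `^ (- a)| < eps / (8 * eta `^ q).
    apply: hd; [exact: measurable_itv|exact: sub0T|].
    rewrite lebesgue_measure_itv/= lte_fin; case: ifPn => _; last by rewrite lte_fin.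
    by rewrite -EFinB lte_fin; lra.
  by under eq_Rintegral do rewrite ger0_norm ?powR_ge0//.
exists (d / 2); first by lra.
move=> u t u0 ut tT tud.
have h1 := hd u t u0 ut tT tud.
have tu0 : 0 <= t - u by lra.
have tuT : t - u <= T by lra.
have tud' : t - u - 0 <= d / 2 by lra.
have h2 := hd 0 (t - u) (lexx _) tu0 tuT tud'.
apply: le_trans (wkernelM_bound e0 u0 ut tT T0) _.
rewrite etap -/M.
have h3 : 4 * r * M <= eps / 2.
  rewrite /r (_ : 4 * _ * _ = (eps / 2) * (M / (M + 1))); last by field; lra.
  by rewrite ler_piMr// ?ler_pdivrMr; lra.
have h4 : eta `^ q * (eps / (8 * eta `^ q)) = eps / 8 by field; rewrite gt_eqF.
have := ler_wpM2l (ltW eq0) h1; have := ler_wpM2l (ltW eq0) h2; rewrite h4.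
lra.
Qed.

Lemma wkernelM_bounded T : 0 < T -> exists2 C, 0 <= C &
  forall t, 0 <= t -> t <= T -> \int[mu]_(s in `]0, t[) (K t s * m s) <= C.
Proof.
move=> T0; set A := \int[mu]_(s in `]0, T[) (s `^ (- a)).
have A0 : 0 <= A by apply: Rintegral_ge0 => s _; exact: powR_ge0.
set M := \int[mu]_(s in `]0, T[) (m s `^ p).
have M0 : 0 <= M by apply: Rintegral_ge0 => s _; exact: powR_ge0.
exists (4 * A + 4 * M); first lra.
move=> t t0 tT.
have := wkernelM_bound ltr01 (lexx 0) t0 tT T0.
rewrite subr0 !powR1 -/M => /le_trans; apply.
suff : \int[mu]_(s in `]0, t[) (s `^ (- a)) <= A by lra.
apply: fine_le.
- by apply: integrable_fin_num; [exact: measurable_itv|exact: integrable_powRN].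
- by apply: integrable_fin_num; [exact: measurable_itv|exact: integrable_powRN].
- apply: ge0_subset_integral; try exact: measurable_itv.
  + by case/integrableP: (integrable_powRN T a1).
  + by move=> s _; rewrite lee_fin powR_ge0.
  + exact: sub0T.
Qed.

End wkernel_estimates.

(** * Extraction of convergent subsequences *)

Section extraction.
Import ArrowAsProduct.
Context {R : realType}.
Implicit Types (f : nat -> R -> R) (y : R -> R).

(** Tychonoff's theorem yields a cluster point in the product topology. An uncountable product is
    not first countable, so no subsequence is claimed yet: only closeness on any given finite set at
    some arbitrarily late index. *)
Lemma pointwise_bounded_cluster f (B : R -> R) : (forall n t, `|f n t| <= B t) ->
  exists y : R -> R, forall (s : seq R) (e : R) (N : nat), 0 < e ->
    exists2 n, (N <= n)%N & forall t, t \in s -> `|f n t - y t| < e.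
Proof.
move=> fB.
have cB (t : R) : compact `[- B t, B t]%classic by exact: segment_compact.
have := @tychonoff R (fun=> R) (fun t => `[- B t, B t]%classic) cB.
move=> /(_ (f @ \oo)) [].
  by exists 0%N => // n _ t /=; rewrite in_itv/= -ler_norml.
move=> y [_ /= cy]; exists y => s e N e0.
have ns : nbhs (y : forall _ : R, R)
    [set z : R -> R | forall t, t \in s -> `|z t - y t| < e].
  elim: s => [|a s ih]; first by apply: filterE => z t; rewrite in_nil.
  have na : nbhs (y : forall _ : R, R) [set z : R -> R | `|z a - y a| < e].
    have := @proj_continuous R (fun=> R) a y.
    move=> /(_ [set v | `|v - y a| < e]); apply.
    by apply/nbhs_ballP; exists e => //= v; rewrite /ball/= distrC.
  apply: filterS (filterI na ih) => z [/= za zs] t.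
  by rewrite inE => /predU1P[->//|]; exact: zs.
have Nf : (f @ \oo) [set f n | n in [set n | (N <= n)%N]].
  by exists N => // n /= Nn; exists n.
by have [_ [[n /= Nn <-] h]] := cy _ _ Nf ns; exists n.
Unshelve. all: by end_near. Qed.

(** [T] bounds the points from above only. This uniformity on a whole half-line is available because
    the Tonelli approximations are constant for t <= 0. *)
Definition equicontinuous_below (I : Type) (F : I -> R -> R) := forall T e : R, 0 < e ->
  exists2 d, 0 < d & forall i u t, u <= t -> t <= T -> t - u <= d ->
    `|F i t - F i u| <= e.

(** Stage j takes an index, at least j, at which [f] is within 1/(j+1) of the cluster point on a
    grid of mesh 1/(j+1) in [-j, j]. Equicontinuity of [f] and of the limit carries the closeness
    from the grid to every point. *)
Lemma extraction f (B : R -> R) : (forall n t, `|f n t| <= B t) ->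
  equicontinuous_below f ->
  exists y (phi : nat -> nat), [/\ forall j, (j <= phi j)%N,
    equicontinuous_below (fun _ : unit => y) &
    forall t, f (phi j) t @[j --> \oo] --> y t].
Proof.
move=> fB fE; have [y hy] := pointwise_bounded_cluster fB.
pose grid j : seq R := [seq k%:R / j.+1%:R - j%:R | k <- iota 0 (2 * (j * j.+1)).+1].
have hphi j : {n | (j <= n)%N & forall t, t \in grid j -> `|f n t - y t| < j.+1%:R^-1}.
  apply: cid2; apply: hy; by rewrite invr_gt0.
(* A modulus of continuity involves two points at a time, so closeness on finite sets is enough to
   pass it to the cluster point. *)
have yE : equicontinuous_below (fun _ : unit => y).
  move=> T e e0; have [d d0 hd] := fE T e e0; exists d => // _ u t ut tT tud.
  apply/ler_addgt0Pr => e' e'0.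
  have e'2 : 0 < e' / 2 by lra.
  have [n _ hn] := hy [:: u; t] (e' / 2) 0%N e'2.
  have := hn u; rewrite !inE eqxx => /(_ isT) hu.
  have := hn t; rewrite !inE eqxx orbT => /(_ isT) ht.
  have := hd n u t ut tT tud.
  move: hu ht; rewrite !ltr_norml !ler_norml => /andP[h1 h2] /andP[h3 h4] /andP[h5 h6].
  by apply/andP; split; lra.
exists y, (fun j => s2val (hphi j)); split => //.
  by move=> j; exact: (s2valP (hphi j)).
move=> t; apply/cvgrPdist_le => e e0.
have e3 : 0 < e / 3 by lra.
have [d d0 hd] := fE t (e / 3) e3.
have [d' d'0 hd'] := yE t (e / 3) e3.
have z0 : 0 < Num.min (Num.min d d') (e / 3) by rewrite !lt_min d0 d'0.
near=> j.
set n := s2val _.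
(* The index of the last grid point not after [t]; rounding down suits the one-sided form of
   equicontinuity. *)
pose k := Num.truncn ((t + j%:R) * j.+1%:R).
have j1 : 0 < j.+1%:R :> R by [].
have tj : `|t| <= j%:R by near: j; exact: nbhs_infty_ger.
have tj0 : 0 <= t + j%:R by move: tj; rewrite ler_norml => /andP[h _]; lra.
have /andP[k1 k2] : k%:R <= (t + j%:R) * j.+1%:R < k.+1%:R.
  by apply: truncn_itv; rewrite mulr_ge0.
pose p : R := k%:R / j.+1%:R - j%:R.
have pj : p \in grid j.
  apply/mapP; exists k => //; rewrite mem_iota/= add0n ltnS.
  rewrite -(ler_nat R) (le_trans k1)// !natrM mulrA ler_wpM2r//.
  by move: tj; rewrite ler_norml => /andP[_ h]; lra.
have pt : p <= t by rewrite /p lerBlDr ler_pdivrMr.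
have tp : t - p <= j.+1%:R^-1.
  have : t + j%:R <= k.+1%:R / j.+1%:R by rewrite ler_pdivlMr// ltW.
  rewrite -(natr1 k) mulrDl mul1r /p.
  by move: (j%:R) (j.+1%:R^-1 : R) (k%:R / _) => x z w; lra.
have jd : j.+1%:R^-1 <= Num.min (Num.min d d') (e / 3).
  by apply: ltW; near: j; exact: (near_infty_natSinv_lt (PosNum z0)).
move: jd; rewrite !le_min => /andP[/andP[jd jd'] je].
have := hd n p t pt (lexx _) (le_trans tp jd).
have := hd' tt p t pt (lexx _) (le_trans tp jd').
have := s2valP' (hphi j) p pj; rewrite -/n => h.
have {}h := le_trans (ltW h) je.
move: h; rewrite !ler_norml => /andP[h1 h2] /andP[h3 h4] /andP[h5 h6].
by apply/andP; split; lra.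
Unshelve. all: by end_near. Qed.

Lemma equicontinuous_below_continuous (I : Type) (F : I -> R -> R) i :
  equicontinuous_below F -> continuous (F i).
Proof.
move=> FE t; apply/cvgrPdist_le => e e0.
have [d d0 hd] := FE (t + 1) e e0.
near=> u.
have : `|t - u| <= Num.min d 1.
  by near: u; apply: (@cvgr_dist_le _ _ _ _ _ id t cvg_id); rewrite lt_min d0 ltr01.
rewrite le_min => /andP[ud u1].
have [tu|ut] := leP t u.
  rewrite distrC; apply: hd => //.
    by move: u1; rewrite ler_norml => /andP[h1 h2]; lra.
  by move: ud; rewrite ler_norml => /andP[h1 h2]; lra.
apply: hd; [exact: ltW|lra|].
by move: ud; rewrite ler_norml => /andP[h1 h2]; lra.
Unshelve. all: by end_near. Qed.

End extraction.

(** * Volterra equations *)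

Lemma Rintegral_itvoo_split {R : realType} (u t : R) (f : R -> R) :
  0 <= u -> u <= t ->
  (@lebesgue_measure R).-integrable `]0, t[ (fun s => (f s)%:E) ->
  \int[lebesgue_measure]_(s in `]0, t[) f s =
  \int[lebesgue_measure]_(s in `]0, u[) f s + \int[lebesgue_measure]_(s in `]u, t[) f s.
Proof.
move=> u0; rewrite le_eqVlt => /predU1P[-> _|ut fi].
  by rewrite [X in _ = _ + X](_ : _ = 0) ?addr0// set_itvoo0 Rintegral_set0.
rewrite -(Rintegral_itvB (x := u) fi) ?bnd_simp//.
rewrite [X in X + _](_ : _ = \int[lebesgue_measure]_(s in `]0, u]) f s).
  by rewrite addrC subrK.
apply: Rintegral_itv_bndo_bndc; apply: integrableS fi; [exact: measurable_itv..|].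
by apply: subset_itvl; rewrite bnd_simp ltW.
Qed.

Lemma integrable_EFinB {R : realType} (D : set R) (f g : R -> R) : measurable D ->
  (@lebesgue_measure R).-integrable D (fun s => (f s)%:E) ->
  (@lebesgue_measure R).-integrable D (fun s => (g s)%:E) ->
  (@lebesgue_measure R).-integrable D (fun s => (f s - g s)%:E).
Proof.
move=> mD fi gi.
have mD' : measurable (D : set (measurableTypeR R)) by [].
exact: eq_integrable (integrableB mD' fi gi).
Qed.

Lemma integrable_EFinZl {R : realType} (D : set R) (c : R) (f : R -> R) : measurable D ->
  (@lebesgue_measure R).-integrable D (fun s => (f s)%:E) ->
  (@lebesgue_measure R).-integrable D (fun s => (c * f s)%:E).
Proof.
move=> mD fi.
have mD' : measurable (D : set (measurableTypeR R)) by [].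
exact: eq_integrable (integrableZl mD' c fi).
Qed.

Section volterra.
Context {R : realType}.
Variables (K : R -> R -> R) (m : R -> R).
Local Notation mu := (@lebesgue_measure R).
Hypothesis K_ge0 : forall t s : R, 0 <= K t s.
Hypothesis mK : forall t (D : set R), measurable_fun D (K t).
Hypothesis K_decr : forall s t1 t2 : R, 0 < s < t1 -> t1 <= t2 -> K t2 s <= K t1 s.
Hypothesis KB_le : forall d s t1 t2 : R, 0 < s -> 0 < d -> s <= t1 - d -> t1 <= t2 ->
  K t1 s - K t2 s <= (t2 - t1) / d * K t1 s.
Hypothesis m_ge0 : forall s : R, 0 < s -> 0 <= m s.
Hypothesis mm : measurable_fun (`]0, +oo[%classic : set R) m.
Hypothesis iKm : forall t : R, mu.-integrable `]0, t[ (fun s => (K t s * m s)%:E).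
Hypothesis Km_small : forall T e : R, 0 < T -> 0 < e -> exists2 d, 0 < d &
  forall u t, 0 <= u -> u <= t -> t <= T -> t - u <= d ->
  \int[mu]_(s in `]u, t[) (K t s * m s) <= e.
Hypothesis Km_bounded : forall T : R, 0 < T -> exists2 C, 0 <= C &
  forall t, 0 <= t -> t <= T -> \int[mu]_(s in `]0, t[) (K t s * m s) <= C.

(** Measurability and domination by a multiple of [m] are all that the estimates ask of [G]; they
    are therefore uniform over all terms g(s, y(s-h)) with y continuous and 1 + |y| <= B. *)
Definition dominated_on (B T : R) (G : R -> R) :=
  measurable_fun (`]0, T[%classic : set R) G /\
  forall s, 0 < s < T -> `|G s| <= B * m s.

Lemma integrable_le_kernel (f : R -> R) (B t u v : R) : 0 <= u -> v <= t ->
  measurable_fun (`]u, v[%classic : set R) f ->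
  (forall s, u < s < v -> `|f s| <= B * (K t s * m s)) ->
  mu.-integrable `]u, v[ (fun s => (f s)%:E).
Proof.
move=> u0 vt mf fB.
have mI : measurable (`]u, v[%classic : set (measurableTypeR R)) by exact: measurable_itv.
have i1 : mu.-integrable `]u, v[ (fun s => (K t s * m s)%:E).
  apply: integrableS (iKm t); [exact: measurable_itv..|].
  by apply: subset_itv; rewrite bnd_simp.
apply: le_integrable (integrableZl mI B i1) => //.
  exact/measurable_EFinP.
move=> s /=; rewrite in_itv/= => /fB h.
by rewrite lee_fin (le_trans h)// ler_norm.
Qed.

Lemma measurable_kernel_mul (t u v : R) (G : R -> R) :
  measurable_fun (`]u, v[%classic : set R) G ->
  measurable_fun (`]u, v[%classic : set R) (fun s => K t s * G s).
Proof. by move=> mG; apply: measurable_funM. Qed.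

Lemma integrable_dominated (B T t u v : R) (G : R -> R) : dominated_on B T G ->
  0 <= u -> v <= t -> v <= T -> mu.-integrable `]u, v[ (fun s => (K t s * G s)%:E).
Proof.
move=> [mG GB] u0 vt vT; apply: (@integrable_le_kernel _ B t) => //.
  apply: measurable_kernel_mul; apply: measurable_funS mG => //.
  by apply: subset_itv; rewrite bnd_simp.
move=> s /andP[us sv]; rewrite normrM (ger0_norm (K_ge0 _ _)) mulrCA.
apply: ler_wpM2l => //; apply: GB; apply/andP; split.
  exact: le_lt_trans us.
exact: lt_le_trans vT.
Qed.

Lemma le_norm_dominated (B T t u v : R) (G : R -> R) : dominated_on B T G ->
  0 <= u -> v <= t -> v <= T ->
  `|\int[mu]_(s in `]u, v[) (K t s * G s)| <= B * \int[mu]_(s in `]u, v[) (K t s * m s).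
Proof.
move=> GB u0 vt vT.
have mI : measurable (`]u, v[%classic : set (measurableTypeR R)) by exact: measurable_itv.
have i1 := integrable_dominated GB u0 vt vT.
have i2 : mu.-integrable `]u, v[ (fun s => (K t s * m s)%:E).
  apply: integrableS (iKm t); [exact: measurable_itv..|].
  by apply: subset_itv; rewrite bnd_simp.
apply: le_trans (le_normr_Rintegral mI i1) _.
rewrite -RintegralZl//; apply: le_Rintegral => //.
- exact: (integrable_abse i1).
- exact: (integrableZl mI B i2).
move=> s /=; rewrite in_itv/= => /andP[us sv].
rewrite normrM (ger0_norm (K_ge0 _ _)) mulrCA.
apply: ler_wpM2l => //; apply GB.2; apply/andP; split.
  exact: le_lt_trans us.
exact: lt_le_trans vT.
Qed.

(** The stretch from t1 to t2 costs B e. On ]0,t1[ the difference K(t1,s) - K(t2,s) is nonnegative,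
    so it is integrated against [m] without absolute values: up to t1 - d0 it is at most (t2-t1)/d0
    times K(t1,s), and on the rest, of length at most d0, K(t2,s) is dropped and the bound e applies
    once more. *)
Lemma kernel_integral_increment (B T d0 C e t1 t2 : R) (G : R -> R) :
  0 <= B -> 0 < d0 ->
  (forall t, 0 <= t -> t <= T -> \int[mu]_(s in `]0, t[) (K t s * m s) <= C) ->
  (forall u t, 0 <= u -> u <= t -> t <= T -> t - u <= d0 ->
    \int[mu]_(s in `]u, t[) (K t s * m s) <= e) ->
  dominated_on B T G -> 0 <= t1 -> t1 <= t2 -> t2 <= T -> t2 - t1 <= d0 ->
  `|\int[mu]_(s in `]0, t2[) (K t2 s * G s) - \int[mu]_(s in `]0, t1[) (K t1 s * G s)|
  <= B * ((t2 - t1) / d0 * C + 2 * e).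
Proof.
move=> B0 d00 hC he GB t10 t12 t2T td.
have t1T : t1 <= T by exact: le_trans t2T.
have mI u v : measurable (`]u, v[%classic : set (measurableTypeR R)).
  exact: measurable_itv.
have i2 := integrable_dominated GB (lexx 0) (lexx t2) t2T.
rewrite (Rintegral_itvoo_split t10 t12 i2).
have i1 := integrable_dominated GB (lexx 0) (lexx t1) t1T.
have i21 := integrable_dominated GB (lexx 0) t12 t1T.
have j1 : mu.-integrable `]0, t1[ (fun s => (K t1 s * m s)%:E) by [].
have j2 : mu.-integrable `]0, t1[ (fun s => (K t2 s * m s)%:E).
  apply: integrableS (iKm t2); [exact: measurable_itv..|].
  by apply: subset_itvl; rewrite bnd_simp.
have h2 : `|\int[mu]_(s in `]t1, t2[) (K t2 s * G s)| <= B * e.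
  apply: le_trans (le_norm_dominated GB t10 (lexx t2) t2T) _.
  by apply: ler_wpM2l => //; exact: he.
set A := \int[mu]_(s in `]0, t1[) (K t2 s * G s).
set E := \int[mu]_(s in `]0, t1[) (K t1 s * G s).
(* The maximum with 0 covers t1 < d0, where the part far from the diagonal is empty. *)
pose w := Num.max 0 (t1 - d0).
have w0 : 0 <= w by rewrite /w le_max lexx.
have wt1 : w <= t1 by rewrite /w ge_max t10/=; lra.
have D1 : \int[mu]_(s in `]0, t1[) (K t1 s * m s - K t2 s * m s) <=
    (t2 - t1) / d0 * C + e.
  have iD : mu.-integrable `]0, t1[ (fun s => (K t1 s * m s - K t2 s * m s)%:E).
    exact: integrable_EFinB.
  rewrite (Rintegral_itvoo_split w0 wt1 iD).
  have sub1 (f : R -> \bar R) : mu.-integrable `]0, t1[ f -> mu.-integrable `]0, w[ f.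
    by apply: integrableS; [exact: measurable_itv..|apply: subset_itvl; rewrite bnd_simp].
  have sub2 (f : R -> \bar R) : mu.-integrable `]0, t1[ f -> mu.-integrable `]w, t1[ f.
    by apply: integrableS; [exact: measurable_itv..|apply: subset_itvr; rewrite bnd_simp].
  apply: lerD.
    apply: (@le_trans _ _ ((t2 - t1) / d0 * \int[mu]_(s in `]0, w[) (K t1 s * m s))).
      rewrite -RintegralZl//; last exact: sub1.
      apply: le_Rintegral => //.
      - exact: sub1.
      - by apply: integrable_EFinZl => //; exact: sub1.
      move=> s /=; rewrite in_itv/= => /andP[s0 sw].
      have std : s <= t1 - d0.
        by move: sw; rewrite /w lt_max ltNge (ltW s0)/= => /ltW.
      rewrite -mulrBl mulrA; apply: ler_wpM2r; first exact: m_ge0.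
      exact: KB_le.
    apply: ler_wpM2l; first by rewrite divr_ge0 ?subr_ge0// ltW.
    apply: le_trans (hC t1 t10 t1T).
    rewrite (Rintegral_itvoo_split w0 wt1 j1) lerDl.
    apply: Rintegral_ge0 => s /=; rewrite in_itv/= => /andP[ws _].
    by apply: mulr_ge0 => //; apply: m_ge0; exact: le_lt_trans ws.
  apply: le_trans (he w t1 w0 wt1 t1T _); last first.
    by rewrite lerBlDr -lerBlDl /w le_max lexx orbT.
  apply: le_Rintegral => //; [exact: sub2..|].
  move=> s /=; rewrite in_itv/= => /andP[ws _].
  rewrite lerBlDr lerDl; apply: mulr_ge0 => //; apply: m_ge0; exact: le_lt_trans ws.
have h1 : `|E - A| <= B * ((t2 - t1) / d0 * C + e).
  rewrite /E /A -RintegralB//.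
  have iGD : mu.-integrable `]0, t1[ (fun s => (K t1 s * G s - K t2 s * G s)%:E).
    exact: integrable_EFinB.
  apply: le_trans (le_normr_Rintegral (mI _ _) iGD) _.
  apply: le_trans (ler_wpM2l B0 D1).
  have iD : mu.-integrable `]0, t1[ (fun s => (K t1 s * m s - K t2 s * m s)%:E).
    exact: integrable_EFinB.
  rewrite -RintegralZl//.
  apply: le_Rintegral => //.
  - exact: (integrable_abse iGD).
  - exact: integrable_EFinZl.
  move=> s /=; rewrite in_itv/= => /andP[s0 st].
  have KK : 0 <= K t1 s - K t2 s by rewrite subr_ge0; apply: K_decr => //; rewrite s0.
  rewrite -!mulrBl normrM (ger0_norm KK) mulrCA; apply: ler_wpM2l => //.
  by apply: GB.2; rewrite s0/= (lt_le_trans st).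
move: h1 h2; rewrite !ler_norml => /andP[a1 a2] /andP[a3 a4].
by apply/andP; split; lra.
Qed.

Lemma kernel_integral_equicontinuous (B T e : R) : 0 <= B -> 0 < T -> 0 < e ->
  exists2 d, 0 < d & forall G t1 t2, dominated_on B T G ->
    t1 <= t2 -> t2 <= T -> t2 - t1 <= d ->
  `|\int[mu]_(s in `]0, t2[) (K t2 s * G s) - \int[mu]_(s in `]0, t1[) (K t1 s * G s)|
  <= e.
Proof.
move=> B0 T0 e0.
(* The increment estimate produces three terms of size B e': one from the Lipschitz part, two from
   short intervals. *)
pose e' := e / (3 * (B + 1)).
have e'0 : 0 < e' by rewrite /e' divr_gt0// mulr_gt0//; lra.
have [d0 d00 he] := Km_small T0 e'0.
have [C C0 hC] := Km_bounded T0.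
(* The second entry of the minimum makes (t2-t1)/d0 times C at most e'. *)
have d1 : 0 < Num.min d0 (d0 * e' / (C + 1)).
  rewrite lt_min d00/=. apply: divr_gt0; first exact: mulr_gt0. by lra.
exists (Num.min d0 (d0 * e' / (C + 1))) => // G t1 t2 GB t12 t2T.
rewrite le_min => /andP[td td'].
have Be : B * e' <= e / 3.
  rewrite /e' (_ : B * _ = e / 3 * (B / (B + 1))); last by field; lra.
  by rewrite ler_piMr ?ler_pdivrMr; lra.
have null (t : R) : t <= 0 -> \int[mu]_(s in `]0, t[) (K t s * G s) = 0.
  by move=> t0; rewrite set_itv_ge ?Rintegral_set0// bnd_simp -leNgt.
have [t20|t20] := leP t2 0.
  by rewrite !null ?subr0 ?normr0 ?(le_trans t12)// ltW.
(* For t1 <= 0 only the integral up to t2 is left, and t2 <= t2-t1 <= d0. *)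
have [t10|t10] := leP t1 0.
  rewrite (null t1)// subr0.
  apply: le_trans (le_norm_dominated GB (lexx 0) (lexx t2) t2T) _.
  have t2d : t2 - 0 <= d0 by lra.
  have := ler_wpM2l B0 (he 0 t2 (lexx 0) (ltW t20) t2T t2d).
  lra.
apply: le_trans (kernel_integral_increment B0 d00 hC he GB (ltW t10) t12 t2T td) _.
have tC : (t2 - t1) / d0 * C <= e'.
  rewrite mulrAC ler_pdivrMr//.
  move: td'; rewrite ler_pdivlMr; last lra.
  have : 0 <= t2 - t1 by lra.
  lra.
have := ler_wpM2l B0 tC.
lra.
Qed.

(** In the norm weighted by exp(-lam t) the kernel has size at most 1/2, which takes the place of a
    Gronwall inequality for a singular kernel. The last stretch of length d contributes 1/4 by
    smallness; before it, the weight gains a factor exp(-lam d). *)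
Lemma kernel_integral_expR (T : R) : 0 < T ->
  exists2 lam : R, 0 <= lam & forall t : R, 0 < t -> t <= T ->
    \int[mu]_(s in `]0, t[) (K t s * (m s * expR (lam * s))) <= expR (lam * t) / 2.
Proof.
move=> T0.
have e0 : 0 < 4^-1 :> R by rewrite invr_gt0.
have [d d0 he] := Km_small T0 e0.
have [C C0 hC] := Km_bounded T0.
(* Chosen so that lam d = 4 C, whence C exp(-lam d) <= C/(1 + 4 C) <= 1/4. *)
pose lam := 4 * C / d.
have lam0 : 0 <= lam by rewrite divr_ge0 ?mulr_ge0// ltW.
exists lam => // t t0 tT.
have mI u v : measurable (`]u, v[%classic : set (measurableTypeR R)).
  exact: measurable_itv.
pose w := Num.max 0 (t - d).
have w0 : 0 <= w by rewrite /w le_max lexx.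
have wt : w <= t by rewrite /w ge_max (ltW t0)/=; lra.
have mE (D : set R) : measurable_fun D (fun s : R => expR (lam * s)).
  apply: measurable_funTS; apply: continuous_measurable_fun => x.
  apply: (@continuous_comp _ _ _ (fun s : R => lam * s) expR).
    by apply: cvgM; [exact: cvg_cst|exact: cvg_id].
  exact: continuous_expR.
have bnd u v c s : 0 <= u -> v <= t -> v <= c -> u < s < v ->
    K t s * (m s * expR (lam * s)) <= expR (lam * c) * (K t s * m s).
  move=> u0 vt vc /andP[us sv]; rewrite mulrA mulrC.
  apply: ler_wpM2r; first by rewrite mulr_ge0// m_ge0// (le_lt_trans u0).
  by rewrite ler_expR ler_wpM2l// ltW// (lt_le_trans sv).
have nn u v s : 0 <= u -> u < s < v -> 0 <= K t s * (m s * expR (lam * s)).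
  move=> u0 /andP[us _]; apply: mulr_ge0 => //; apply: mulr_ge0; last exact: expR_ge0.
  by apply: m_ge0; exact: le_lt_trans us.
have iE u v : 0 <= u -> v <= t ->
    mu.-integrable `]u, v[ (fun s => (K t s * (m s * expR (lam * s)))%:E).
  move=> u0 vt; apply: (@integrable_le_kernel _ (expR (lam * t)) t) => //.
    apply: measurable_kernel_mul; apply: measurable_funM => //.
    apply: measurable_funS mm => // s /=.
    by rewrite !in_itv/= andbT => /andP[us _]; exact: le_lt_trans us.
  by move=> s us; rewrite ger0_norm ?(nn u v)//; exact: (bnd u v).
have iK u v : 0 <= u -> v <= t -> mu.-integrable `]u, v[ (fun s => (K t s * m s)%:E).
  move=> u0 vt; apply: integrableS (iKm t); [exact: measurable_itv..|].
  by apply: subset_itv; rewrite bnd_simp.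
have piece u v c : 0 <= u -> v <= t -> v <= c ->
    \int[mu]_(s in `]u, v[) (K t s * (m s * expR (lam * s))) <=
    expR (lam * c) * \int[mu]_(s in `]u, v[) (K t s * m s).
  move=> u0 vt vc; rewrite -RintegralZl//; last exact: iK.
  apply: le_Rintegral => //; first exact: iE.
    by apply: integrable_EFinZl => //; exact: iK.
  by move=> s /=; rewrite in_itv/=; exact: bnd.
rewrite (Rintegral_itvoo_split w0 wt (iE _ _ (lexx 0) (lexx t))).
have -> : expR (lam * t) / 2 = expR (lam * t) / 4 + expR (lam * t) / 4 by field.
apply: lerD; last first.
  apply: le_trans (piece w t t w0 (lexx t) (lexx t)) _.
  apply: ler_wpM2l; first exact: expR_ge0.
  by apply: he => //; rewrite lerBlDr -lerBlDl /w le_max lexx orbT.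
have [td|td] := leP (t - d) 0.
  rewrite /w (max_idPl td) set_itvoo0 Rintegral_set0.
  by rewrite divr_ge0 ?expR_ge0.
have wE : w = t - d by apply/max_idPr; exact: ltW.
have wtd : w <= t - d by rewrite wE.
apply: le_trans (piece 0 w (t - d) (lexx 0) wt wtd) _.
have hCw : \int[mu]_(s in `]0, w[) (K t s * m s) <= C.
  apply: le_trans (hC t (ltW t0) tT).
  rewrite (Rintegral_itvoo_split w0 wt (iKm t)) lerDl.
  apply: Rintegral_ge0 => s /=; rewrite in_itv/= => /andP[ws _].
  by apply: mulr_ge0 => //; apply: m_ge0; exact: le_lt_trans ws.
apply: le_trans (ler_wpM2l (expR_ge0 _) hCw) _.
rewrite mulrBr expRB -mulrA; apply: ler_wpM2l; first exact: expR_ge0.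
have -> : lam * d = 4 * C by rewrite /lam divfK// gt_eqF.
have := expR_ge1Dx (4 * C).
move=> h.
rewrite mulrC ler_pdivrMr ?expR_gt0//; lra.
Qed.

Lemma integrable_kernel_expR (lam t : R) : 0 <= lam ->
  mu.-integrable `]0, t[ (fun s => (K t s * (m s * expR (lam * s)))%:E).
Proof.
move=> lam0; apply: (@integrable_le_kernel _ (expR (lam * t)) t) => //.
  apply: measurable_kernel_mul; apply: measurable_funM.
    apply: measurable_funS mm => // s /=.
    by rewrite !in_itv/= andbT => /andP[].
  apply: measurable_funTS; apply: continuous_measurable_fun => x.
  apply: (@continuous_comp _ _ _ (fun s : R => lam * s) expR).
    by apply: cvgM; [exact: cvg_cst|exact: cvg_id].
  exact: continuous_expR.
move=> s /andP[s0 st].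
have Km0 : 0 <= K t s * m s by apply: mulr_ge0 => //; exact: m_ge0.
rewrite mulrA normrM (ger0_norm Km0) (ger0_norm (expR_ge0 _)) mulrC.
by apply: ler_wpM2r => //; rewrite ler_expR ler_wpM2l// ltW.
Qed.

Variables (g : R * R -> R) (x0 : R).
Hypothesis g_cont : forall s y : R, 0 < s -> {for (s, y), continuous g}.
Hypothesis g_le : forall s y : R, 0 < s -> `|g (s, y)| <= m s * (1 + `|y|).

(** For [h] = 0 this is the right-hand side of the equation; for [h] > 0 the value at [t] involves
    [y] only before t - h. The empty integral gives x0 for t <= 0, which supplies the history that s
    - h may reach. *)
Definition volterra (h : R) (y : R -> R) (t : R) : R :=
  x0 + \int[mu]_(s in `]0, t[) (K t s * g (s, y (s - h))).

Lemma volterra_le0 h y (t : R) : t <= 0 -> volterra h y t = x0.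
Proof.
move=> t0; rewrite /volterra set_itv_ge ?Rintegral_set0 ?addr0//.
by rewrite bnd_simp -leNgt.
Qed.

Lemma eq_volterra h y1 y2 (t : R) : (forall s, s < t - h -> y1 s = y2 s) ->
  volterra h y1 t = volterra h y2 t.
Proof.
move=> y12; congr (_ + _); apply: eq_Rintegral => s.
by rewrite inE/= in_itv/= => /andP[_ st]; rewrite y12// ltrD2r.
Qed.

Lemma dominated_delay (h : R) (y : R -> R) (B T : R) : 0 <= h -> continuous y ->
  (forall s : R, s <= T -> 1 + `|y s| <= B) ->
  dominated_on B T (fun s => g (s, y (s - h))).
Proof.
move=> h0 cy yB; split.
  apply: open_continuous_measurable_fun; first exact: interval_open.
  move=> s; rewrite inE/= in_itv/= => /andP[s0 _].
  have cyh : y (s - h) @[s --> s] --> y (s - h).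
    apply: (@continuous_comp _ _ _ (fun s : R => s - h) y); last exact: cy.
    by apply: cvgB; [exact: cvg_id|exact: cvg_cst].
  have cp : (s, y (s - h)) @[s --> s] --> (s, y (s - h))
    by apply: (@cvg_pair _ _ _ _ (nbhs s) (nbhs (y (s - h)))) => //; exact: cvg_id.
  have cg := g_cont (y := y (s - h)) s0.
  exact: (cvg_comp _ _ cp cg).
move=> s /andP[s0 sT]; apply: le_trans (g_le _ s0) _.
rewrite mulrC; apply: ler_wpM2r; first exact: m_ge0.
by apply: yB; rewrite lerBlDr (le_trans (ltW sT))// lerDl.
Qed.

(** With A = 2 (1 + |x0|) the bound A exp(lam max(0,t)) reproduces itself: 1 + |x0| is A/2, and the
    integral adds at most (A/2) exp(lam t). The delay is harmless because the bound is nondecreasing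
    in t. *)
Lemma volterra_growth (h : R) (y : R -> R) (T lam : R) : 0 <= h -> continuous y ->
  0 <= lam ->
  (forall t : R, 0 < t -> t <= T ->
    \int[mu]_(s in `]0, t[) (K t s * (m s * expR (lam * s))) <= expR (lam * t) / 2) ->
  (forall t : R, t <= T -> 1 + `|y t| <= 2 * (1 + `|x0|) * expR (lam * Num.max 0 t)) ->
  forall t : R, t <= T -> 1 + `|volterra h y t| <= 2 * (1 + `|x0|) * expR (lam * Num.max 0 t).
Proof.
move=> h0 cy lam0 hlam yB t tT.
set A := 2 * (1 + `|x0|).
have A0 : 0 <= A by rewrite /A mulr_ge0// addr_ge0.
have [t0|t0] := leP t 0.
  rewrite volterra_le0// mulr0 expR0 mulr1 /A.
  by have := normr_ge0 x0; lra.
have yB' s : s <= t -> 1 + `|y s| <= A * expR (lam * t).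
  move=> st; apply: le_trans (yB s (le_trans st tT)) _.
  apply: ler_wpM2l => //; rewrite ler_expR; apply: ler_wpM2l => //.
  by rewrite ge_max (ltW t0).
have GB := dominated_delay h0 cy yB'.
have mI : measurable (`]0, t[%classic : set (measurableTypeR R)).
  exact: measurable_itv.
have iG := integrable_dominated GB (lexx 0) (lexx t) (lexx t).
have iE := integrable_kernel_expR t lam0.
have : `|\int[mu]_(s in `]0, t[) (K t s * g (s, y (s - h)))| <=
    A * (expR (lam * t) / 2).
  apply: le_trans (le_normr_Rintegral mI iG) _.
  apply: le_trans (ler_wpM2l A0 (hlam t t0 tT)).
  rewrite -RintegralZl//; apply: le_Rintegral => //.
  - exact: (integrable_abse iG).
  - exact: integrable_EFinZl.
  move=> s /=; rewrite in_itv/= => /andP[s0 st].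
  rewrite normrM (ger0_norm (K_ge0 _ _)) mulrCA; apply: ler_wpM2l => //.
  apply: le_trans (g_le _ s0) _.
  rewrite mulrCA; apply: ler_wpM2l; first exact: m_ge0.
  have sh : s - h <= s by rewrite lerBlDr lerDl.
  apply: le_trans (yB (s - h) _) _; first by rewrite (le_trans sh)// (le_trans (ltW st)).
  apply: ler_wpM2l => //; rewrite ler_expR; apply: ler_wpM2l => //.
  by rewrite ge_max (ltW s0).
have E1 : 1 <= expR (lam * t).
  by rewrite -expR0 ler_expR mulr_ge0// ltW.
have := ler_normD x0 (\int[mu]_(s in `]0, t[) (K t s * g (s, y (s - h)))).
rewrite -/(volterra h y t) => h1 h2.
have A2 : 1 + `|x0| = A / 2 by rewrite /A mulrC mulKf.
have h3 : A / 2 <= A * (expR (lam * t) / 2).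
  by rewrite mulrA ler_wpM2r// ler_peMr.
apply: (@le_trans _ _ (1 + (`|x0| + A * (expR (lam * t) / 2)))).
  by rewrite lerD2l (le_trans h1)// lerD2l.
rewrite addrA A2 [leRHS](_ : _ = A * (expR (lam * t) / 2) + A * (expR (lam * t) / 2)).
  by rewrite lerD2r.
by rewrite -mulrDr -splitr.
Qed.

Lemma volterra_equicontinuous (B T e : R) : 0 <= B -> 0 < T -> 0 < e ->
  exists2 d, 0 < d & forall (h : R) (y : R -> R), 0 <= h -> continuous y ->
    (forall s : R, s <= T -> 1 + `|y s| <= B) ->
    forall u t, u <= t -> t <= T -> t - u <= d ->
    `|volterra h y t - volterra h y u| <= e.
Proof.
move=> B0 T0 e0; have [d d0 hd] := kernel_integral_equicontinuous B0 T0 e0.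
exists d => // h y h0 cy yB u t ut tT tud.
rewrite /volterra opprD addrACA subrr add0r.
by apply: hd => //; exact: dominated_delay.
Qed.

(** Iterating the delayed operator from a constant replaces the usual construction interval by
    interval; by [tonelli_stable] the i-th iterate is final for t <= i h. *)
Definition tonelli (h : R) (i : nat) : R -> R := iter i (volterra h) (cst x0).

(** A joint induction: both the growth and the continuity of an iterate rest on the growth and the
    continuity of its predecessor, the latter for measurability of the integrand. *)
Lemma tonelli_growth (h : R) i : 0 <= h -> continuous (tonelli h i) /\
  forall T lam : R, 0 < T -> 0 <= lam ->
  (forall t : R, 0 < t -> t <= T ->
    \int[mu]_(s in `]0, t[) (K t s * (m s * expR (lam * s))) <= expR (lam * t) / 2) ->
  forall t : R, t <= T ->
  1 + `|tonelli h i t| <= 2 * (1 + `|x0|) * expR (lam * Num.max 0 t).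
Proof.
move=> h0; elim: i => [|i [ci ih]].
  split; first by move=> x; exact: cvg_cst.
  move=> T lam T0 lam0 _ t tT; rewrite /tonelli/=.
  have : 1 <= expR (lam * Num.max 0 t).
    by rewrite -expR0 ler_expR mulr_ge0// le_max lexx.
  move=> h1; apply: (@le_trans _ _ (2 * (1 + `|x0|))).
    by rewrite ler_peMl// ?addr_ge0// ler1n.
  by rewrite ler_peMr// mulr_ge0// addr_ge0.
split; last first.
  move=> T lam T0 lam0 hlam; apply: volterra_growth => //.
  exact: ih.
move=> x; apply: (@equicontinuous_below_continuous _ unit (fun=> tonelli h i.+1) tt).
move=> T0 e e0.
pose T := Num.max T0 1.
have T1 : 0 < T by rewrite lt_max ltr01 orbT.
have [lam lam0 hlam] := kernel_integral_expR T1.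
pose B := 2 * (1 + `|x0|) * expR (lam * T).
have B0 : 0 <= B by rewrite !mulr_ge0// ?addr_ge0// expR_ge0.
have [d d0 hd] := volterra_equicontinuous B0 T1 e0.
exists d => // _ u t ut tT tud; apply: hd => //.
  move=> s sT; apply: le_trans (ih T lam T1 lam0 hlam s sT) _.
  apply: ler_wpM2l; first by rewrite mulr_ge0// addr_ge0.
  by rewrite ler_expR; apply: ler_wpM2l => //; rewrite ge_max (ltW T1).
by rewrite (le_trans tT)// le_max lexx.
Qed.

Lemma tonelli_bounded (T : R) : exists2 B, 0 <= B & forall (h : R) i (t : R),
  0 <= h -> t <= T -> 1 + `|tonelli h i t| <= B.
Proof.
pose T' := Num.max T 1.
have T1 : 0 < T' by rewrite lt_max ltr01 orbT.
have [lam lam0 hlam] := kernel_integral_expR T1.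
exists (2 * (1 + `|x0|) * expR (lam * T')).
  by rewrite !mulr_ge0// ?addr_ge0// expR_ge0.
move=> h i t h0 tT; have [_ hB] := tonelli_growth i h0.
have tT' : t <= T' by rewrite (le_trans tT)// le_max lexx.
apply: le_trans (hB T' lam T1 lam0 hlam t tT') _.
apply: ler_wpM2l; first by rewrite mulr_ge0// addr_ge0.
by rewrite ler_expR; apply: ler_wpM2l => //; rewrite ge_max (ltW T1).
Qed.

(** Each iteration reads its predecessor only before t - h, so the range of agreement advances by
    [h]. *)
Lemma tonelli_stable (h : R) i (t : R) : 0 <= h -> t <= i%:R * h ->
  tonelli h i.+1 t = tonelli h i t.
Proof.
move=> h0; elim: i t => [|i ih] t ti.
  by rewrite /tonelli/= volterra_le0//; rewrite mul0r in ti.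
rewrite -[LHS]/(volterra h (tonelli h i.+1) t) -[RHS]/(volterra h (tonelli h i) t).
apply: eq_volterra => s sth.
apply: ih; rewrite (le_trans (ltW sth))// lerBlDr.
by rewrite -[X in _ <= _ + X]mul1r -mulrDl natr1.
Qed.

Lemma tonelli_equicontinuous (I : Type) (h : I -> R) (i : I -> nat) :
  (forall n, 0 <= h n) -> equicontinuous_below (fun n => tonelli (h n) (i n)).
Proof.
move=> h0 T0 e e0; pose T := Num.max T0 1.
have T1 : 0 < T by rewrite lt_max ltr01 orbT.
have [B B0 hB] := tonelli_bounded T.
have [d d0 hd] := volterra_equicontinuous B0 T1 e0.
exists d => // n u t ut tT tud.
case: (i n) => [|k]; first by rewrite /tonelli/= subrr normr0 ltW.
rewrite /tonelli iterS; apply: hd => //.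
- by have [] := tonelli_growth k (h0 n).
- by move=> s sT; exact: hB.
by rewrite (le_trans tT)// le_max lexx.
Qed.

Theorem volterra_exists : exists2 y : R -> R, continuous y &
  forall t, y t = volterra 0 y t.
Proof.
pose h n : R := n.+1%:R^-1.
have h0 n : 0 <= h n by rewrite invr_ge0.
(* With delay 1/(n+1), n (n+1) iterations reach n: [f n] solves the delayed equation exactly for t
   <= n. *)
pose f n := tonelli (h n) (n * n.+1).
have fE : equicontinuous_below f by exact: tonelli_equicontinuous.
have fcont n : continuous (f n) by have [] := tonelli_growth (n * n.+1) (h0 n).
have ffix n t : t <= n%:R -> f n t = volterra (h n) (f n) t.
  move=> tn; rewrite /f -[RHS]/(tonelli (h n) (n * n.+1).+1 t) tonelli_stable//.
  by rewrite natrM -mulrA mulfV ?mulr1// pnatr_eq0.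
have /choice[B hB] (T : R) : exists B, 0 <= B /\ forall n t, t <= T -> 1 + `|f n t| <= B.
  have [B B0 hB] := tonelli_bounded T.
  by exists B; split => // n t tT; exact: hB.
have fB n t : `|f n t| <= B t.
  by have [_ /(_ n t (lexx t))] := hB t; have := normr_ge0 (f n t); lra.
have [y [phi [phij yE fy]]] := extraction fB fE.
have cy : continuous y by exact: (equicontinuous_below_continuous (i := tt) yE).
have hcvg0 : h (phi j) @[j --> \oo] --> (0 : R).
  apply: (@squeeze_cvgr _ _ _ _ (cst 0) (fun j => j.+1%:R^-1)).
  - near=> j; rewrite h0/= lef_pV2 ?posrE// ler_nat ltnS; exact: phij.
  - exact: cvg_cst.
  - exact: cvg_harmonic.
(* The argument moves with j, so pointwise convergence alone is not enough; equicontinuity, uniform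
   in the index, absorbs the shift. *)
have delay (s : R) : f (phi j) (s - h (phi j)) @[j --> \oo] --> y s.
  apply/cvgrPdist_le => e e0.
  have e2 : 0 < e / 2 by lra.
  have [d d0 hd] := fE s (e / 2) e2.
  have h1 : \forall j \near \oo, `|y s - f (phi j) s| <= e / 2.
    by move/cvgrPdist_le : (fy s) => /(_ _ e2).
  have h2 : \forall j \near \oo, `|0 - h (phi j)| <= d.
    by move/cvgrPdist_le : hcvg0 => /(_ _ d0).
  near=> j.
  have h1j : `|y s - f (phi j) s| <= e / 2 by near: j.
  have : `|0 - h (phi j)| <= d by near: j.
  rewrite sub0r normrN ger0_norm// => hjd.
  have shs : s - h (phi j) <= s by rewrite lerBlDr lerDl.
  have ssh : s - (s - h (phi j)) <= d by rewrite opprB addrC subrK.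
  have := hd (phi j) (s - h (phi j)) s shs (lexx s) ssh.
  move: h1j; rewrite !ler_norml => /andP[a1 a2] /andP[a3 a4].
  by apply/andP; split; lra.
exists y => // t.
have [t0|t0] := leP t 0.
  rewrite volterra_le0//; apply/(cvg_unique _ (fy t)) => //.
  apply: cvg_near_cst; near=> j.
  rewrite ffix ?volterra_le0//.
  by rewrite (le_trans t0).
apply/(cvg_unique _ (fy t)) => //.
have [_ hBt] := hB t.
have hy s : s <= t -> 1 + `|y s| <= B t.
  move=> st; rewrite -lerBrDl.
  apply/ler_addgt0Pr => e e0.
  have [j _ /(_ j (leqnn j)) hj] : \forall j \near \oo, `|y s - f (phi j) s| <= e.
    by move/cvgrPdist_le : (fy s) => /(_ _ e0).
  have := hBt (phi j) s st; have := ler_normD (y s - f (phi j) s) (f (phi j) s).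
  rewrite subrK; lra.
have dG j : dominated_on (B t) t (fun s => g (s, f (phi j) (s - h (phi j)))).
  by apply: dominated_delay => // s st; exact: hBt.
have dy : dominated_on (B t) t (fun s => g (s, y (s - 0))).
  by apply: dominated_delay.
have mI : measurable (`]0, t[%classic : set (measurableTypeR R)).
  exact: measurable_itv.
have iG j := integrable_dominated (dG j) (lexx 0) (lexx t) (lexx t).
have iy := integrable_dominated dy (lexx 0) (lexx t) (lexx t).
(* For j >= t the approximation at [t] equals its own image, so the images converge to the same
   limit; dominated convergence with majorant B(t) K(t,s) m(s) identifies that limit. *)
suff : volterra (h (phi j)) (f (phi j)) t @[j --> \oo] --> volterra 0 y t.
  apply: cvg_trans; apply: near_eq_cvg; near=> j.
  have tj : t <= j%:R by near: j; exact: nbhs_infty_ger.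
  by rewrite -ffix// (le_trans tj)// ler_nat.
apply: cvgD; first exact: cvg_cst.
apply: fine_cvg; rewrite fineK; last exact: integrable_fin_num.
have [] := @dominated_convergence _ (measurableTypeR R) R mu `]0, t[%classic mI
  (fun j s => (K t s * g (s, f (phi j) (s - h (phi j))))%:E)
  (fun s => (K t s * g (s, y (s - 0)))%:E) (fun s => (B t * (K t s * m s))%:E).
- by move=> j; exact: measurable_int (iG j).
- exact: measurable_int iy.
- apply/aeW => s /=; rewrite in_itv/= => /andP[s0 st].
  apply/cvg_EFin; first by near=> j.
  apply: cvgM; first exact: cvg_cst.
  have cp : (s, f (phi j) (s - h (phi j))) @[j --> \oo] --> (s, y s).
    by apply: (@cvg_pair _ _ _ _ (nbhs s) (nbhs (y s))) => //; exact: cvg_cst.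
  rewrite subr0; exact: (cvg_comp _ _ cp (g_cont (y := y s) s0)).
- exact: integrable_EFinZl.
- apply/aeW => s j /=; rewrite in_itv/= => st.
  rewrite lee_fin normrM (ger0_norm (K_ge0 _ _)) mulrCA.
  by apply: ler_wpM2l => //; exact: (dG j).2.
by [].
Unshelve. all: by end_near. Qed.

End volterra.

(** * The Euler integrals *)

Section euler_integrals.
Context {R : realType}.
Local Notation mu := (@lebesgue_measure R).

Lemma integrable_cst_itvoo01 (c : R) : mu.-integrable `]0, 1[ (EFin \o cst c).
Proof.
apply/integrableP; split; first exact/measurable_EFinP.
rewrite (_ : (fun x => _) = cst `|c|%:E)// integral_cst//=.
by rewrite lebesgue_measure_itv/= lte_fin ltr01 oppr0 adde0 mule1 ltry.
Qed.

Definition beta_kernel (a : R) (u t s : R) : R :=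
  (t - s) `^ (- a) * (s - u) `^ (- (1 - a)).

(** Euler's Beta integral B(a, 1-a). *)
Definition beta_const (a : R) : R := \int[mu]_(v in `]0, 1[) beta_kernel a 0 1 v.

Lemma beta_kernel_ge0 (a u t s : R) : 0 <= beta_kernel a u t s.
Proof. by rewrite mulr_ge0 ?powR_ge0. Qed.

Lemma measurable_beta_kernel (a u t : R) (D : set R) :
  measurable_fun D (beta_kernel a u t).
Proof.
apply: measurable_funM; first exact: measurable_powRN_reflect.
apply: measurable_funTS.
rewrite (_ : (fun s => _) = (fun x : R => x `^ (- (1 - a))) \o (fun s : R => s - u))//.
apply: measurableT_comp; [exact: measurable_powR|exact: measurable_funB].
Qed.

(** On each half of ]0,1[ one of the two factors is at most 2, so twice the sum of the powers is a
    majorant. *)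
Lemma integrable_beta_kernel01 (a : R) : 0 < a < 1 ->
  mu.-integrable `]0, 1[ (fun s => (beta_kernel a 0 1 s)%:E).
Proof.
move=> /andP[a0 a1].
have b1 : 1 - a < 1 by lra.
have mI : measurable (`]0, 1[%classic : set (measurableTypeR R)).
  exact: measurable_itv.
have i1 := integrable_powRN 1 b1.
have i2 := integrable_powRN_reflect 1 a1.
have i12 := integrable_EFinZl 2 mI (integrableD mI i1 i2).
apply: le_integrable i12 => //.
  by apply/measurable_EFinP; exact: measurable_beta_kernel.
have half (x c : R) : 0 < c -> c <= 1 -> 2^-1 <= x -> x `^ (- c) <= 2.
  move=> c0 c1 x2.
  have x0 : 0 < x by lra.
  rewrite powRN -[leRHS]invrK lef_pV2 ?posrE ?powR_gt0 ?invr_gt0//.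
  have [x1|x1] := leP x 1.
    by apply: le_trans x2 _; apply: ger1_powR => //; rewrite x0.
  apply: (@le_trans _ _ 1); first by lra.
  by rewrite -[leLHS](powRr0 x); apply: ler_powR; exact: ltW.
move=> s /=; rewrite in_itv/= => /andP[s0 s1].
rewrite lee_fin ger0_norm ?beta_kernel_ge0//.
apply: le_trans (ler_norm _).
rewrite /beta_kernel subr0.
have := powR_ge0 (1 - s) (- a); have := powR_ge0 s (- (1 - a)).
have [s2|s2] := leP 2^-1 s.
  have := half s (1 - a); set x := s `^ _; set y := (1 - s) `^ _.
  have h1 : 0 < 1 - a by lra.
  have h2 : 1 - a <= 1 by lra.
  move=> /(_ h1 h2 s2); nra.
have := half (1 - s) a a0 (ltW a1); set x := s `^ _; set y := (1 - s) `^ _.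
have s3 : 2^-1 <= 1 - s by lra.
move=> /(_ s3); nra.
Qed.

Lemma beta_const_gt0 (a : R) : 0 < a < 1 -> 0 < beta_const a.
Proof.
move=> a01; have /andP[a0 a1] := a01.
apply: (@lt_le_trans _ _ (\int[mu]_(v in `]0, 1[) 1)).
  by rewrite Rintegral_cst//= lebesgue_measure_itv/= lte_fin ltr01 oppr0 adde0 mulr1.
have mI : measurable (`]0, 1[%classic : set (measurableTypeR R)).
  exact: measurable_itv.
apply: le_Rintegral => //.
- exact: integrable_cst_itvoo01.
- exact: integrable_beta_kernel01.
move=> s; rewrite /= in_itv/= => /andP[s0 s1].
have h (x c : R) : 0 < c -> 0 < x -> x <= 1 -> 1 <= x `^ (- c).
  move=> c0 x0 x1; rewrite -[leLHS](powRr0 x); apply: ger_powR; [by rewrite x0|lra].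
rewrite /beta_kernel subr0 -[leLHS]mulr1; apply: ler_pM => //; apply: h => //; lra.
Qed.

(** The substitution s = (t-u) v + u brings out the Jacobian t-u and, the exponents adding up to -1,
    also its inverse. *)
Lemma integral_beta_kernel (a u t : R) : 0 < a < 1 -> u < t ->
  (\int[mu]_(s in `]u, t[) (beta_kernel a u t s)%:E = (beta_const a)%:E)%E.
Proof.
move=> a01 ut.
have r0 : 0 < t - u by rewrite subr_gt0.
have mI : measurable (`]0, 1[%classic : set (measurableTypeR R)).
  exact: measurable_itv.
rewrite (@ge0_integral_affine _ (t - u) u)//; first last.
- by move=> x _; rewrite lee_fin beta_kernel_ge0.
- by apply/measurable_EFinP; exact: measurable_beta_kernel.
have -> : affine (t - u) u @^-1` `]u, t[ = `]0, 1[%classic :> set R.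
  apply/seteqP; split => x /=; rewrite /affine !in_itv/= => /andP[h1 h2].
    by apply/andP; split; nra.
  by apply/andP; split; nra.
rewrite -[X in (X * _)%E]/((t - u)%:E).
have iB := integrable_beta_kernel01 a01.
rewrite /beta_const /Rintegral fineK; last exact: integrable_fin_num.
have E s : s \in (`]0, 1[%classic : set R) ->
    (beta_kernel a u t (affine (t - u) u s))%:E =
    ((t - u)^-1%:E * (beta_kernel a 0 1 s)%:E)%E.
  rewrite inE/= in_itv/= => /andP[s0 s1]; rewrite -EFinM; congr EFin.
  rewrite /beta_kernel /affine.
  have -> : t - ((t - u) * s + u) = (t - u) * (1 - s) by ring.
  have -> : (t - u) * s + u - u = (t - u) * s by ring.
  rewrite subr0 !powRM ?(ltW r0) ?(ltW s0) ?subr_ge0 ?(ltW s1)//.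
  rewrite mulrACA; congr (_ * _).
  rewrite -powRD; last by apply/implyP => _; rewrite gt_eqF.
  by rewrite -powR_inv1 ?(ltW r0)//; congr (_ `^ _); ring.
transitivity ((t - u)%:E *
    \int[mu]_(s in `]0%R, 1%R[) ((t - u)^-1%:E * (beta_kernel a 0 1 s)%:E))%E.
  by congr (_ * _)%E; exact: eq_integral.
rewrite integralZl//.
by rewrite muleA -EFinM mulfV ?mul1e// gt_eqF.
Qed.

Lemma integrable_beta_kernel (a u t : R) : 0 < a < 1 -> u < t ->
  mu.-integrable `]u, t[ (fun s => (beta_kernel a u t s)%:E).
Proof.
move=> a01 ut; apply/integrableP; split.
  by apply/measurable_EFinP; exact: measurable_beta_kernel.
under eq_integral do rewrite gee0_abs ?lee_fin ?beta_kernel_ge0//.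
by rewrite integral_beta_kernel// ltry.
Qed.

(** Integrability has to come first, since a divergent integral would have the default real value 0.
    The majorant is s^(a-1) on ]0,1[ plus exp(-s); the lower bound exp(-1) comes from ]0,1[. *)
Lemma Gamma_gt0 (a : R) : 0 < a -> a <= 1 -> 0 < Gamma a.
Proof.
move=> a0 a1; rewrite /Gamma.
have mIy : measurable (`]0, +oo[%classic : set (measurableTypeR R)).
  exact: measurable_itv.
have mI : measurable (`]0, 1[%classic : set (measurableTypeR R)).
  exact: measurable_itv.
have ie : mu.-integrable `]0, +oo[ (fun s : R => (expR (- s))%:E).
  (* On the positive half-line exp(-s) is the density of the exponential law, of total mass 1. *)
  have : mu.-integrable setT (fun s => (exponential_pdf 1 s : R)%:E).
    apply/integrableP; split.
      by apply/measurable_EFinP; exact: measurable_exponential_pdf.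
    under eq_integral do rewrite gee0_abs ?lee_fin ?exponential_pdf_ge0//.
    by rewrite integral_exponential_pdf ?ltry.
  move=> /(integrableS measurableT mIy (subsetT _)).
  apply: eq_integrable => // s; rewrite inE/= in_itv/= andbT => s0.
  rewrite /exponential_pdf patchE mem_set/= ?mul1r ?mulN1r//.
  by rewrite in_itv/= andbT ltW.
have ip : mu.-integrable `]0, +oo[ (EFin \o (fun s : R => s `^ (a - 1)) \_ `]0, 1[).
  rewrite -restrict_EFin; apply/integrable_restrict => //=.
  rewrite setIidr; last by move=> s /=; rewrite !in_itv/= andbT => /andP[].
  have := integrable_powRN 1 (a := 1 - a); rewrite opprB; apply; lra.
have mG (D : set R) : measurable_fun D (fun t : R => t `^ (a - 1) * expR (- t)).
  apply: measurable_funM; first exact: measurable_funTS (measurable_powR _).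
  apply: measurable_funTS.
  rewrite (_ : (fun s => _) = (@expR R) \o (fun s : R => - s))//.
  by apply: measurableT_comp; [exact: measurable_expR|exact: oppr_measurable].
have iG : mu.-integrable `]0, +oo[ (fun t : R => (t `^ (a - 1) * expR (- t))%:E).
  apply: le_integrable (integrableD mIy ip ie) => //.
    by apply/measurable_EFinP; exact: mG.
  move=> s /=; rewrite in_itv/= andbT => s0.
  rewrite lee_fin ger0_norm ?mulr_ge0 ?powR_ge0 ?expR_ge0//.
  apply: le_trans (ler_norm _); rewrite patchE.
  case: ifPn => [|/negP s1].
    rewrite inE/= in_itv/= => /andP[_ s1].
    have e1 : expR (- s) <= 1 by rewrite -expR0 ler_expR lerNl oppr0 ltW.
    have := powR_ge0 s (a - 1); have := expR_ge0 (- s); nra.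
  have {}s1 : 1 <= s.
    by rewrite leNgt; apply/negP => h; apply: s1; rewrite inE/= in_itv/= s0.
  rewrite add0r ler_piMl ?expR_ge0// -[leRHS](powRr0 s); apply: ler_powR => //; lra.
apply: (@lt_le_trans _ _ (\int[mu]_(v in `]0, 1[) expR (-1))).
  rewrite Rintegral_cst//= lebesgue_measure_itv/= lte_fin ltr01 oppr0 adde0 mulr1.
  exact: expR_gt0.
have s01 : `]0, 1[ `<=` (`]0, +oo[%classic : set R).
  by move=> s /=; rewrite !in_itv/= andbT => /andP[].
apply: (@le_trans _ _ (\int[mu]_(t in `]0, 1[) (t `^ (a - 1) * expR (- t)))).
  apply: le_Rintegral => //.
  - exact: integrable_cst_itvoo01.
  - exact: integrableS iG.
  move=> s; rewrite /= in_itv/= => /andP[s0 s1].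
  rewrite -[leLHS]mul1r; apply: ler_pM => //; rewrite ?expR_ge0//.
    by rewrite -[leLHS](powRr0 s); apply: ger_powR; [rewrite s0 ltW|lra].
  by rewrite ler_expR lerN2 ltW.
apply: fine_le.
- by apply: integrable_fin_num => //; exact: integrableS iG.
- exact: integrable_fin_num.
- apply: ge0_subset_integral => //.
  + by apply/measurable_EFinP; exact: mG.
  + by move=> s _; rewrite lee_fin mulr_ge0 ?powR_ge0 ?expR_ge0.
Qed.

End euler_integrals.

(** * Abel's identity for kernels of complementary exponents *)

Section abel.
Context {R : realType}.
Local Notation mu := (@lebesgue_measure R).

(** Powers are cut off at nonpositive arguments, where they have conventional values. Together with
    the extension [ext] by zero, this confines the integrand [H] to 0 < u < s < t, and Fubini's
    theorem can be used on the whole plane. *)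
Let P (c : R) : R -> R := (fun r => r `^ (- c)) \_ `]0, +oo[.

Let mP (c : R) : measurable_fun setT (P c).
Proof.
apply/(measurable_restrictT _ _).1 => //.
exact: measurable_funTS (measurable_powR _).
Qed.

Let P_gt0 (c r : R) : 0 < r -> P c r = r `^ (- c).
Proof. by move=> r0; rewrite /P patchE mem_set//= in_itv/= r0. Qed.

Let P_le0 (c r : R) : r <= 0 -> P c r = 0.
Proof.
move=> r0; rewrite /P patchE memNset//= in_itv/= andbT; apply/negP.
by rewrite -leNgt.
Qed.

Let P_ge0 (c r : R) : 0 <= P c r.
Proof. by have [r0|r0] := leP r 0; [rewrite P_le0|rewrite P_gt0 ?powR_ge0]. Qed.

Variables (a t : R) (phi : R -> R).
Hypothesis a01 : 0 < a < 1.
Hypothesis t0 : 0 < t.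
Hypothesis iphi : mu.-integrable `]0, t[ (EFin \o phi).
Hypothesis iJ : forall s : R, 0 < s < t ->
  mu.-integrable `]0, s[ (fun u => ((s - u) `^ (- (1 - a)) * phi u)%:E).

Let J (s : R) := \int[mu]_(u in `]0, s[) ((s - u) `^ (- (1 - a)) * phi u).

Let ext : R -> R := phi \_ `]0, t[.

Let Q (u s : R) : R := P a (t - s) * P (1 - a) (s - u).

Let QE (u : R) : Q u = beta_kernel a u t \_ `]u, t[.
Proof.
apply/funext => s; rewrite /Q patchE; case: ifPn.
  by rewrite inE/= in_itv/= => /andP[us st]; rewrite !P_gt0 ?subr_gt0.
rewrite notin_setE/= in_itv/= => /negP; rewrite negb_and -!leNgt => /orP[h|h].
  by rewrite (@P_le0 (1 - a)) ?mulr0// subr_le0.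
by rewrite (@P_le0 a) ?mul0r// subr_le0.
Qed.

Let iQ (u : R) : u < t -> mu.-integrable setT (EFin \o Q u).
Proof.
move=> ut; rewrite QE -restrict_EFin; apply/integrable_restrict => //=.
by rewrite setTI; exact: integrable_beta_kernel.
Qed.

Let intQ (u : R) : u < t -> (\int[mu]_s (Q u s)%:E = (beta_const a)%:E)%E.
Proof.
move=> ut; rewrite -(integral_beta_kernel a01 ut) [RHS]integral_mkcond.
by rewrite restrict_EFin QE.
Qed.

Let H (z : R * R) : R := ext z.2 * Q z.2 z.1.

Let ext_ge (u : R) : t <= u -> ext u = 0.
Proof.
move=> tu; rewrite /ext patchE memNset//= in_itv/= => /andP[_].
by rewrite ltNge tu.
Qed.

Let mH : measurable_fun setT (EFin \o H).
Proof.
apply/measurable_EFinP; apply: measurable_funM.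
  apply: measurableT_comp => //.
  apply/(measurable_restrictT _ _).1 => //.
  by apply/measurable_EFinP; case/integrableP: iphi.
apply: measurable_funM.
  rewrite (_ : (fun z => _) = P a \o (fun z : R * R => t - z.1))//.
  apply: measurableT_comp; first exact: mP.
  by apply: measurable_funB => //; exact: measurable_fst.
rewrite (_ : (fun z => _) = P (1 - a) \o (fun z : R * R => z.1 - z.2))//.
apply: measurableT_comp; first exact: mP.
by apply: measurable_funB.
Qed.

(** The factor [c] serves two purposes: the sign of [ext u] gives the integral of |H|, and 1 gives
    the integral of H. *)
Let intH (c : R) (u : R) : (\int[mu]_s (c * ext u * Q u s)%:E =
  (c * ext u * beta_const a)%:E)%E.
Proof.
have [ut|tu] := ltP u t.
  under eq_integral do rewrite EFinM.
  rewrite integralZl//; last exact: iQ.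
  by rewrite intQ.
rewrite ext_ge// mulr0 mul0r.
by under eq_integral do rewrite mul0r; rewrite integral0.
Qed.

Let iext : mu.-integrable setT (EFin \o ext).
Proof. by rewrite /ext -restrict_EFin; apply/integrable_restrict => //=; rewrite setTI. Qed.

(** By Tonelli's criterion: integrating |H| in s leaves [beta_const a] times |ext u|, which is
    integrable because the constant does not depend on u. *)
Let iH : (mu \x mu)%E.-integrable setT (EFin \o H).
Proof.
apply/integrable21ltyP => //=.
have E (u : R) : (\int[mu]_s `|(H (s, u))%:E| = `|(beta_const a * ext u)%:E|)%E.
  transitivity (\int[mu]_s (Num.sg (ext u) * ext u * Q u s)%:E)%E.
    apply: eq_integral => s _; rewrite /H/= normrM (ger0_norm (_ : 0 <= Q u s)).
      by rewrite -normrEsg.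
    by rewrite mulr_ge0 ?P_ge0.
  rewrite intH -normrEsg; congr EFin.
  by rewrite normrM mulrC (ger0_norm (ltW (beta_const_gt0 a01))).
under eq_integral do rewrite E.
have := @integrable_EFinZl _ setT (beta_const a) ext measurableT iext.
by case/integrableP.
Qed.

Let fubini_FE : fubini_F mu (EFin \o H) =
  (fun s => ((t - s) `^ (- a) * J s)%:E) \_ `]0, t[.
Proof.
apply/funext => s; rewrite /fubini_F patchE; case: ifPn.
  rewrite inE/= in_itv/= => /andP[s0 st].
  have s0t : 0 < s < t by rewrite s0.
  rewrite EFinM /J /Rintegral fineK; last first.
    by apply: integrable_fin_num => //; exact: iJ.
  rewrite -integralZl//; last exact: iJ.
  rewrite [RHS]integral_mkcond; apply: eq_integral => u _.
  rewrite /H /Q /= patchE; case: ifPn.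
    rewrite inE/= in_itv/= => /andP[u0 us].
    rewrite !P_gt0 ?subr_gt0// /ext patchE mem_set; last first.
      by rewrite /= in_itv/= u0 (lt_trans us).
    by rewrite -EFinM; congr EFin; ring.
  rewrite notin_setE/= in_itv/= => /negP; rewrite negb_and -!leNgt => /orP[h|h].
    rewrite /ext patchE memNset ?mul0r//= in_itv/= => /andP[h' _].
    by rewrite ltNge h in h'.
  by rewrite (@P_le0 (1 - a)) ?mulr0 ?mulr0// subr_le0.
rewrite notin_setE/= in_itv/= => /negP; rewrite negb_and -!leNgt => st.
apply: integral0_eq => u _; rewrite /H /Q /=; congr EFin.
case/orP: st => st; last by rewrite (@P_le0 a) ?mul0r ?mulr0// subr_le0.
have [us|su] := leP u s; last first.
  by rewrite (@P_le0 (1 - a)) ?mulr0 ?mulr0// subr_le0 ltW.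
rewrite /ext patchE memNset ?mul0r//= in_itv/= => /andP[u0 _].
by have := lt_le_trans u0 (le_trans us st); rewrite ltxx.
Qed.

Lemma abel_integrable :
  mu.-integrable `]0, t[ (fun s => ((t - s) `^ (- a) * J s)%:E).
Proof.
have mI : measurable (`]0, t[%classic : set (measurableTypeR R)).
  exact: measurable_itv.
apply/(integrable_mkcond _ mI).
rewrite -fubini_FE; exact: integrable_fubini_F.
Qed.

Lemma abel_integral :
  \int[mu]_(s in `]0, t[) ((t - s) `^ (- a) * J s) =
  beta_const a * \int[mu]_(u in `]0, t[) phi u.
Proof.
have mI : measurable (`]0, t[%classic : set (measurableTypeR R)).
  exact: measurable_itv.
rewrite -RintegralZl//; congr fine.
rewrite integral_mkcond -fubini_FE [RHS]integral_mkcond.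
have := Fubini iH; rewrite /fubini_F => ->.
apply: eq_integral => u _; rewrite /H /=.
have := intH 1 u; rewrite mul1r => ->.
by rewrite mulrC /ext !patchE; case: ifPn => //; rewrite mulr0.
Qed.

End abel.

(** * Absolute continuity and derivative of a primitive *)

Section primitive.
Context {R : realType}.
Local Notation mu := (@lebesgue_measure R).

(** The sum of the increments is at most the integral of |phi| over the union of the disjoint
    intervals, whose measure is their total length. *)
Lemma abs_cont_primitive (C T : R) (phi : R -> R) :
  mu.-integrable `]0, T[ (EFin \o phi) ->
  abs_cont 0 T (fun t => C + \int[mu]_(s in `]0, t[) phi s).
Proof.
move=> iphi e e0.
have [d d0 hd] := integral_abs_continuous (measurable_itv _) iphi e0.
exists d => // n u v uv tuv sd.
pose A := \big[setU/set0]_(i <- enum 'I_n) (`]u i, v i[%classic : set R).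
have mA : measurable A by apply: bigsetU_measurable => i _; exact: measurable_itv.
have AT : A `<=` `]0, T[.
  rewrite /A => x; rewrite -bigcup_seq => -[i _ /=]; rewrite !in_itv/= => /andP[h1 h2].
  have [h3 _ h4] := uv i.
  by rewrite (le_lt_trans h3 h1) (lt_le_trans h2 h4).
have tA : trivIset [set` enum 'I_n] (fun i => `]u i, v i[%classic).
  exact: sub_trivIset tuv.
have bigA (g : R -> \bar R) : measurable_fun A g -> (forall x, A x -> 0 <= g x)%E ->
    (\int[mu]_(x in A) g x = \sum_(i < n) \int[mu]_(x in `]u i, v i[) g x)%E.
  move=> mg g0.
  rewrite [LHS](@ge0_integral_bigsetU _ (measurableTypeR R) R mu _
    (fun i => `]u i, v i[%classic) g (enum 'I_n))//; last exact: enum_uniq.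
  by rewrite big_enum.
have muA : (mu A < d%:E)%E.
  rewrite -[mu A]mul1e -integral_cst// bigA//.
  rewrite (_ : (\sum_(i < n) _)%E = (\sum_(i < n) (v i - u i))%:E) ?lte_fin//.
  rewrite -sumEFin; apply: eq_bigr => i _.
  rewrite integral_cst// mul1e [LHS](lebesgue_measure_itv `]u i, v i[)/= lte_fin.
  case: ifPn => [//|]; rewrite -leNgt => vu.
  have [_ uv' _] := uv i.
  by have -> : u i = v i; [apply/eqP; rewrite eq_le uv'|rewrite subrr].
have := hd A mA AT muA; apply: le_lt_trans.
rewrite -lee_fin [leRHS](_ : _ = (\int[mu]_(x in A) `|phi x|%:E)%E); last first.
  rewrite /Rintegral fineK//; apply: integrable_fin_num => //.
  have iA : mu.-integrable A (EFin \o phi).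
    by apply: integrableS iphi => //; exact: measurable_itv.
  exact: (integrable_abse iA).
rewrite bigA//; last first.
  apply/measurable_EFinP; apply: measurableT_comp => //.
  apply: measurable_funS AT _ => //.
  by apply/measurable_EFinP; case/integrableP: iphi.
rewrite -sumEFin; apply: lee_sum => i _.
have [u0 uvi vT] := uv i.
have iv : mu.-integrable `]0, v i[ (fun s => (phi s)%:E).
  apply: integrableS iphi; [exact: measurable_itv..|].
  by apply: subset_itvl; rewrite bnd_simp.
have iuv : mu.-integrable `]u i, v i[ (fun s => (phi s)%:E).
  apply: integrableS iv; [exact: measurable_itv..|].
  by apply: subset_itvr; rewrite bnd_simp.
rewrite /= (Rintegral_itvoo_split u0 uvi iv) opprD addrACA subrr add0r.
rewrite addrAC subrr add0r.
have -> : (\int[mu]_(s in `]u i, v i[) `|phi s|%:E)%E =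
    (\int[mu]_(s in `]u i, v i[) `|phi s|)%:E.
  rewrite /Rintegral fineK//; apply: integrable_fin_num => //.
  exact: (integrable_abse iuv).
by rewrite lee_fin; apply: le_normr_Rintegral.
Qed.

Lemma derive1_primitive (C t : R) (phi : R -> R) : 0 < t ->
  mu.-integrable `]0, t + 1[ (EFin \o phi) -> {for t, continuous phi} ->
  is_derive t (1 : R) (fun t => C + \int[mu]_(s in `]0, t[) phi s) (phi t).
Proof.
move=> t0 iphi cphi.
(* The fundamental theorem is applied on a range ending beyond [t], and t + 1/2 still lies inside
   the domain of integrability. *)
have t1 : t < t + 2^-1 by rewrite ltrDl invr_gt0.
have iphi' : mu.-integrable [set` Interval (BRight 0) (BRight (t + 2^-1))] (EFin \o phi).
  apply: integrableS iphi; [exact: measurable_itv..|].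
  by move=> s /=; rewrite !in_itv/= => /andP[-> h]/=; lra.
have t0' : (BRight 0 < BRight t)%O by rewrite bnd_simp.
pose F (y : R) := \int[mu]_(s in [set` Interval (BRight 0) (BRight y)]) phi s.
have [dF eF] : derivable F t 1 /\ derive1 F t = phi t := continuous_FTC1 t1 iphi' t0' cphi.
have hF : is_derive t (1 : R) F (phi t) by split => //; rewrite -derive1E.
have := is_deriveD (is_derive_cst C t (1 : R)) hF.
rewrite add0r => -[h1 h2].
have hnear : {near t, cst C + F =1 (fun t => C + \int[mu]_(s in `]0, t[) phi s)}.
  near=> s.
  have st : s < t + 1 by near: s; apply: lt_nbhsl; rewrite ltrDl.
  rewrite fctE/= /F; congr (_ + _); apply/esym.
  apply: Rintegral_itv_bndo_bndc; apply: integrableS iphi; [exact: measurable_itv..|].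
  by apply: subset_itvl; rewrite bnd_simp ltW.
split; first exact: near_eq_derivable h1.
by rewrite -h2; apply/esym/near_eq_derive.
Unshelve. all: by end_near. Qed.

End primitive.

(** * From the Volterra equation to the differential equation *)

Lemma continuous_powR_pos {R : realType} (c s : R) : 0 < s ->
  {for s, continuous (fun x : R => x `^ c)}.
Proof.
move=> s0; apply: differentiable_continuous; apply/derivable1_diffP.
by apply: derivable_powR; rewrite in_itv/= s0.
Qed.

Section solution.
Context {R : realType}.
Local Notation mu := (@lebesgue_measure R).
Variables (beta x0 : R) (y phi : R -> R).
Hypothesis beta01 : 0 < beta < 1.
Hypothesis y_cont : continuous y.
Hypothesis y_at0 : y 0 = x0.
Hypothesis phi_cont : forall s : R, 0 < s -> {for s, continuous phi}.
Hypothesis iphi : forall T : R, mu.-integrable `]0, T[ (EFin \o phi).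
Hypothesis iJ : forall s : R,
  mu.-integrable `]0, s[ (fun u => ((s - u) `^ (- (1 - beta)) * phi u)%:E).
Let J (s : R) := \int[mu]_(u in `]0, s[) ((s - u) `^ (- (1 - beta)) * phi u).
Let c := Gamma (1 - beta) / beta_const beta.
Hypothesis y_volterra : forall t : R, 0 < t ->
  y t = x0 + t `^ (1 - beta) * (c * J t).

Let x (t : R) : R := t `^ (- (1 - beta)) * y t.

Let xE (s : R) : 0 < s -> x s = x0 * s `^ (- (1 - beta)) + c * J s.
Proof.
move=> s0; rewrite /x y_volterra// mulrDr; congr (_ + _); first exact: mulrC.
rewrite mulrA -powRD; last by apply/implyP => _; rewrite gt_eqF.
by rewrite addNr powRr0 mul1r.
Qed.

(** The x0 term of [x] meets (t-s)^(-beta) in a Beta integral, constant in [t]; the [J] term is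
    Abel's identity, and [c] times [beta_const beta] cancels the prefactor 1/Gamma(1-beta). *)
Let RL_integralE (t : R) : 0 < t -> RL_integral (1 - beta) x t =
  x0 * beta_const beta / Gamma (1 - beta) + \int[mu]_(s in `]0, t[) phi s.
Proof.
move=> t0.
have B0 := beta_const_gt0 beta01.
have G0 : 0 < Gamma (1 - beta).
  by case/andP: beta01 => b0 b1; apply: Gamma_gt0; lra.
pose h (s : R) := x0 * beta_kernel beta 0 t s + c * ((t - s) `^ (- beta) * J s).
have mI : measurable (`]0, t[%classic : set (measurableTypeR R)).
  exact: measurable_itv.
have i1 := integrable_EFinZl x0 mI (integrable_beta_kernel beta01 t0).
have i2 := integrable_EFinZl c mI (abel_integrable beta01 (iphi t) (fun s _ => iJ s)).
have ih : mu.-integrable `]0, t[ (EFin \o h).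
  exact: eq_integrable (integrableD mI i1 i2).
have E : {in (`]0, t[%classic : set R),
    (fun s => x s / (t - s) `^ (1 - (1 - beta))) =1 h}.
  move=> s; rewrite inE/= in_itv/= => /andP[s0 st].
  rewrite xE// /h /beta_kernel subr0 subKr -powRN; ring.
rewrite /RL_integral [X in _ * X](_ : _ = \int[mu]_(s in `]0, t[) h s); last first.
  rewrite /Rintegral integral_itv_bndoo.
    by congr fine; apply: eq_integral => s st; rewrite E.
  apply/measurable_EFinP; apply: (eq_measurable_fun h).
    by move=> s st; rewrite E.
  by apply/measurable_EFinP; case/integrableP: ih.
rewrite /h RintegralD// RintegralZl//; last exact: integrable_beta_kernel.
rewrite RintegralZl//; last exact: (abel_integrable beta01 (iphi t) (fun s _ => iJ s)).
rewrite (abel_integral beta01 (iphi t) (fun s _ => iJ s)).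
rewrite [X in x0 * X](_ : _ = beta_const beta); last first.
  by rewrite {1}/Rintegral integral_beta_kernel.
rewrite /c; field.
by rewrite !gt_eqF.
Qed.

Let x_cont (s : R) : 0 < s -> {for s, continuous x}.
Proof. by move=> s0; apply: cvgM; [exact: continuous_powR_pos|exact: y_cont]. Qed.

Let x_lim : t `^ (1 - beta) * x t @[t --> 0^'+] --> x0.
Proof.
have : y t @[t --> 0^'+] --> x0.
  by rewrite -y_at0; apply: cvg_at_right_filter; exact: y_cont.
apply: cvg_trans; apply: near_eq_cvg; near=> t.
have t0 : 0 < t by [].
rewrite /x mulrA -powRD; last by apply/implyP => _; rewrite gt_eqF.
by rewrite subrr powRr0 mul1r.
Unshelve. all: by end_near. Qed.

Lemma RL_solution_of_volterra (f : R * R -> R) :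
  (forall s, 0 < s -> phi s = f (s, x s)) -> RL_solution beta x0 f x.
Proof.
move=> phiE; split => //.
- split; last by exists x0; exact: x_lim.
  apply: continuous_in_subspaceT => s; rewrite inE/= in_itv/= andbT => s0.
  exact: x_cont.
- move=> T T0; split.
    exists (fun t => x0 * beta_const beta / Gamma (1 - beta) +
        \int[mu]_(s in `]0, t[) phi s); first exact: abs_cont_primitive.
    by move=> t; rewrite in_itv/= => /andP[t0 _]; exact: RL_integralE.
  (* Continuity of [phi] gives the equation at every t > 0, hence almost everywhere. *)
  apply/aeW => t; rewrite in_itv/= => /andP[t0 _].
  have [] := derive1_primitive (x0 * beta_const beta / Gamma (1 - beta)) t0
    (iphi (t + 1)) (phi_cont t0).
  set F := fun _ => _ => dF eF.
  have FRL : {near t, F =1 RL_integral (1 - beta) x}.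
    near=> s; rewrite RL_integralE//; near: s; exact: lt_nbhsr.
  split; first exact: near_eq_derivable dF.
  rewrite -phiE// -eF /RL_derive derive1E.
  by apply/esym/near_eq_derive.
Unshelve. all: by end_near. Qed.

End solution.

(** This is where gamma <= 1 enters: growth of order gamma becomes the linear growth that the
    exponential weight can control. *)
Lemma powR_le1D {R : realType} (z r : R) : 0 <= z -> 0 <= r <= 1 -> z `^ r <= 1 + z.
Proof.
move=> z0 /andP[r0 r1]; have [z1|z1] := leP z 1.
  apply: (@le_trans _ _ (1 `^ r)); first by apply: ge0_ler_powR; rewrite ?nnegrE.
  by rewrite powR1 lerDl.
apply: le_trans (ler1_powR (ltW z1) r1) _.
by rewrite lerDr.
Qed.

(** * The right-hand side in the weighted variable *)

Section weighted_field.
Context {R : realType}.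
Local Notation mu := (@lebesgue_measure R).
Variables (b c gamma p : R) (f : R * R -> R) (l k : R -> R).
Hypothesis c_gt0 : 0 < c.
Hypothesis gamma01 : 0 < gamma <= 1.
Hypothesis p_ge1 : 1 <= p.
Hypothesis hf : {within [set z : R * R | 0 < z.1], continuous f}.
Hypothesis hl0 : forall t : R, 0 < t -> 0 <= l t.
Hypothesis hk0 : forall t : R, 0 < t -> 0 <= k t.
Hypothesis hfb : forall t y : R, 0 < t -> `|f (t, y)| <= l t * `|y| `^ gamma + k t.

Definition weighted_field (z : R * R) : R :=
  c * (z.1 `^ b * f (z.1, z.1 `^ (- b) * z.2)).

Let wl (t : R) : R := t `^ ((1 - gamma) * b) * l t.
Let wk (t : R) : R := t `^ b * k t.

Definition weighted_bound (s : R) : R := c * (wl s + wk s).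

Let wl_ge0 (s : R) : 0 < s -> 0 <= wl s.
Proof. by move=> s0; rewrite mulr_ge0 ?powR_ge0// hl0. Qed.

Let wk_ge0 (s : R) : 0 < s -> 0 <= wk s.
Proof. by move=> s0; rewrite mulr_ge0 ?powR_ge0// hk0. Qed.

Lemma weighted_bound_ge0 (s : R) : 0 < s -> 0 <= weighted_bound s.
Proof.
by move=> s0; rewrite mulr_ge0 ?(ltW c_gt0)// addr_ge0 ?wl_ge0 ?wk_ge0.
Qed.

(** Inserting s^(-b) y into l(s) |x|^gamma brings out s^(-b gamma); multiplied by s^b, it leaves
    s^((1-gamma) b), the weight in the hypotheses on [l]. *)
Lemma weighted_field_le (s y : R) : 0 < s ->
  `|weighted_field (s, y)| <= weighted_bound s * (1 + `|y|).
Proof.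
move=> s0; rewrite /weighted_field /weighted_bound /= normrM (ger0_norm (ltW c_gt0)) -mulrA.
apply: ler_wpM2l; first exact: ltW.
rewrite normrM (ger0_norm (powR_ge0 _ _)).
apply: (@le_trans _ _ (wl s * `|y| `^ gamma + wk s)).
  rewrite (_ : wl s * _ + _ =
      s `^ b * (l s * `|s `^ (- b) * y| `^ gamma + k s)).
    by apply: ler_wpM2l; [exact: powR_ge0|exact: hfb].
  rewrite /wl /wk normrM (ger0_norm (powR_ge0 _ _)) powRM ?powR_ge0// -powRrM.
  rewrite mulrDr; congr (_ + _).
  rewrite (_ : (1 - gamma) * b = b + - b * gamma); last by ring.
  rewrite powRD; last by apply/implyP => _; rewrite gt_eqF.
  ring.
have g01 : 0 <= gamma <= 1 by case/andP: gamma01 => /ltW -> ->.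
have h := ler_wpM2l (wl_ge0 s0) (powR_le1D (normr_ge0 y) g01).
rewrite mulrDl lerD//.
by rewrite ler_peMr ?wk_ge0// lerDl.
Qed.

Lemma continuous_field (s y : R) : 0 < s -> {for (s, y), continuous f}.
Proof.
move=> s0.
have oD : open [set z : R * R | 0 < z.1].
  rewrite (_ : [set z | _] = fst @^-1` [set u : R | 0 < u])//.
  by apply: open_comp; [move=> z _; exact: cvg_fst|exact: open_gt].
move: hf; rewrite continuous_open_subspace//; apply.
by rewrite inE.
Qed.

Lemma continuous_weighted_field (s y : R) : 0 < s ->
  {for (s, y), continuous weighted_field}.
Proof.
move=> s0.
have c1 (d : R) : (fst z : R) `^ d @[z --> (s, y)] --> s `^ d.
  apply: (@cvg_comp _ _ _ (fst : R * R -> R) (fun r : R => r `^ d)).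
    exact: cvg_fst.
  exact: continuous_powR_pos.
have c2 : z.1 `^ (- b) * z.2 @[z --> (s, y)] --> s `^ (- b) * y.
  by apply: cvgM; [exact: c1|exact: cvg_snd].
have c3 : (z.1, z.1 `^ (- b) * z.2) @[z --> (s, y)] --> (s, s `^ (- b) * y).
  apply: (@cvg_pair _ _ _ _ (nbhs s) (nbhs (s `^ (- b) * y))) => //.
  exact: cvg_fst.
apply: cvgM; first exact: cvg_cst.
apply: cvgM; first exact: c1.
exact: (cvg_comp _ _ c3 (continuous_field (y := s `^ (- b) * y) s0)).
Qed.

Lemma measurable_weighted_bound : continuous_pos wl -> continuous_pos wk ->
  measurable_fun (`]0, +oo[%classic : set R) weighted_bound.
Proof.
move=> cl ck; apply: measurable_funM => //.
by apply: measurable_funD; apply: subspace_continuous_measurable_fun.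
Qed.

Lemma integrable_weighted_bound : Lp_loc p wl -> Lp_loc p wk ->
  forall T : R, 0 < T -> mu.-integrable `]0, T[ (fun s => (weighted_bound s `^ p)%:E).
Proof.
move=> lL kL T T0.
have p1 : (1 <= p%:E)%E by rewrite lee_fin.
have := (Lfun_addr_closed mu p1).2 _ _ (lL T T0) (kL T T0).
move=> /(Lfun_integrable p_ge1).
have mI : measurable (`]0, T[%classic : set (measurableTypeR R)).
  exact: measurable_itv.
move=> /(integrableS measurableT mI (subsetT _)) /(integrable_EFinZl (c `^ p) mI).
apply: eq_integrable => // s; rewrite inE/= in_itv/= => /andP[s0 sT]; congr EFin.
have sI : s \in (`[0, T]%classic : set R) by rewrite inE/= in_itv/= !ltW.
have w0 : 0 <= wl s + wk s by rewrite addr_ge0 ?wl_ge0 ?wk_ge0.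
by rewrite fctE !patchE sI (ger0_norm w0) -powRM// ltW.
Qed.

End weighted_field.

Theorem corollary3p8 (R : realType) (beta x0 gamma p q : R)
    (f : R * R -> R) (l k : R -> R)
    (hbeta : 0 < beta < 1)
    (hgamma : 0 < gamma <= 1)
    (hp : 1 / beta < p)
    (hq : q = p / (p - 1))
    (hf : {within [set z : R * R | 0 < z.1], continuous f})
    (hl0 : forall t : R, 0 < t -> 0 <= l t)
    (hk0 : forall t : R, 0 < t -> 0 <= k t)
    (hfb : forall t y : R, 0 < t -> `|f (t, y)| <= l t * `|y| `^ gamma + k t)
    (hlC : continuous_pos (fun t : R => t `^ ((1 - gamma) * (1 - beta)) * l t))
    (hlL : Lp_loc p (fun t : R => t `^ ((1 - gamma) * (1 - beta)) * l t))
    (hkC : continuous_pos (fun t : R => t `^ (1 - beta) * k t))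
    (hkL : Lp_loc p (fun t : R => t `^ (1 - beta) * k t)) :
  exists x : R -> R, RL_solution beta x0 f x.
Proof.
have /andP[beta0 beta1] := hbeta.
pose b := 1 - beta.
have b01 : 0 < b < 1 by rewrite /b; apply/andP; split; lra.
have bp : (1 - b)^-1 < p by rewrite /b subKr -div1r.
have [p1 _ _ _] := conjugate_exponent b01 bp.
pose c := Gamma b / beta_const beta.
have c0 : 0 < c.
  by rewrite divr_gt0 ?beta_const_gt0// Gamma_gt0 /b//; lra.
pose m := weighted_bound b c gamma l k.
pose g := weighted_field b c f.
have m0 : forall s : R, 0 < s -> 0 <= m s by exact: weighted_bound_ge0.
have mm := measurable_weighted_bound (b := b) c hlC hkC.
have mLp := integrable_weighted_bound (b := b) c0 (ltW p1) hl0 hk0 hlL hkL.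
have g_cont := continuous_weighted_field (b := b) (c := c) hf.
have g_le := weighted_field_le b c0 hgamma hl0 hk0 hfb.
have [y cy yE] := @volterra_exists R (wkernel b) m
  (wkernel_ge0 b) (measurable_wkernel b) (le_wkernel b01) (wkernelB_le b01)
  m0 mm (integrable_wkernelM b01 bp m0 mm mLp) (wkernelM_small b01 bp m0 mm mLp)
  (wkernelM_bounded b01 bp m0 mm mLp) g x0 g_cont g_le.
have y_le0 (t : R) : t <= 0 -> y t = x0 by move=> t0; rewrite yE volterra_le0.
pose phi (s : R) := f (s, s `^ (- b) * y s).
have phi_cont (s : R) : 0 < s -> {for s, continuous phi}.
  move=> s0.
  have cs : s `^ (- b) * y s @[s --> s] --> s `^ (- b) * y s.
    by apply: cvgM; [exact: continuous_powR_pos|exact: cy].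
  have cp : (s, s `^ (- b) * y s) @[s --> s] --> (s, s `^ (- b) * y s).
    by apply: (@cvg_pair _ _ _ _ (nbhs s) (nbhs (s `^ (- b) * y s))) => //; exact: cvg_id.
  exact: (cvg_comp _ _ cp (continuous_field hf (y := s `^ (- b) * y s) s0)).
(* Since [y] equals x0 for s <= 0, its maximum on [0, T] controls the whole half-line that
   [dominated_delay] asks for. *)
have y_bounded (T : R) : 0 < T -> exists B, forall s, s <= T -> 1 + `|y s| <= B.
  move=> T0.
  have cny : {within `[0, T], continuous (fun s => `|y s|)}.
    apply: continuous_subspaceT => s; apply: cvg_norm; exact: cy.
  have [z _ hz] := EVT_max (ltW T0) cny.
  exists (1 + (`|y z| + `|x0|)) => s sT; rewrite lerD2l.
  have [s0|s0] := leP s 0; first by rewrite y_le0// lerDr.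
  have sI : s \in `[0, T] by rewrite in_itv/= sT andbT ltW.
  by apply: le_trans (hz s sI) _; rewrite lerDl.
(* The s^(-b) of the kernel cancels the s^b of [g], which leaves the Riemann-Liouville kernel
   applied to [phi]. *)
have KgE (t s : R) : 0 < s < t -> wkernel b t s * g (s, y s) =
    t `^ b * c * ((t - s) `^ (- b) * phi s).
  move=> /andP[s0 st]; rewrite /wkernel /g /weighted_field /= -/(phi s).
  have ss : s `^ (- b) * s `^ b = 1.
    rewrite -powRD ?addNr ?powRr0//; last by apply/implyP => _; rewrite gt_eqF.
  transitivity (t `^ b * c * ((t - s) `^ (- b) * phi s) * (s `^ (- b) * s `^ b)).
    by ring.
  by rewrite ss mulr1.
have iKg (t : R) : lebesgue_measure.-integrable `]0, t[
    (fun s => (wkernel b t s * g (s, y s))%:E).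
  have [t0|t0] := leP t 0.
    by rewrite set_itv_ge ?bnd_simp -?leNgt//; exact: integrable_set0.
  have [B hB] := y_bounded t t0.
  have dom : dominated_on m B t (fun s => g (s, y (s - 0))).
    by apply: dominated_delay => //.
  have := integrable_dominated (wkernel_ge0 b) (measurable_wkernel b)
    (integrable_wkernelM b01 bp m0 mm mLp) dom (lexx 0) (lexx t) (lexx t).
  by apply: eq_integrable => // s _; rewrite subr0.
have iJ (t : R) : lebesgue_measure.-integrable `]0, t[
    (fun s => ((t - s) `^ (- (1 - beta)) * phi s)%:E).
  have [t0|t0] := leP t 0.
    by rewrite set_itv_ge ?bnd_simp -?leNgt//; exact: integrable_set0.
  have mI : measurable (`]0, t[%classic : set (measurableTypeR R)).
    exact: measurable_itv.
  have := integrable_EFinZl (t `^ b * c)^-1 mI (iKg t).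
  apply: eq_integrable => // s; rewrite inE/= in_itv/= => st; congr EFin.
  by rewrite KgE// mulKf// gt_eqF// mulr_gt0// powR_gt0.
(* On ]0,t[ one has (t-s)^(-b) >= t^(-b), so integrability against the kernel gives integrability of
   [phi] itself. *)
have iphi (t : R) : lebesgue_measure.-integrable `]0, t[ (EFin \o phi).
  have mI : measurable (`]0, t[%classic : set (measurableTypeR R)).
    exact: measurable_itv.
  apply: le_integrable (integrable_EFinZl (t `^ b) mI (iJ t)) => //.
    apply/measurable_EFinP; apply: open_continuous_measurable_fun.
      exact: interval_open.
    by move=> s; rewrite inE/= in_itv/= => /andP[s0 _]; exact: phi_cont.
  move=> s /=; rewrite in_itv/= => /andP[s0 st].
  have t0 : 0 < t by exact: lt_trans st.
  have ts0 : 0 < t - s by rewrite subr_gt0.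
  rewrite lee_fin !normrM !(ger0_norm (powR_ge0 _ _)) mulrA ler_peMl//.
  rewrite -/b powRN ler_pdivlMr ?powR_gt0// mul1r.
  by apply: ge0_ler_powR; rewrite ?nnegrE; lra.
have yV (t : R) : 0 < t -> y t = x0 + t `^ (1 - beta) *
    (Gamma (1 - beta) / beta_const beta *
     \int[lebesgue_measure]_(u in `]0, t[) ((t - u) `^ (- (1 - beta)) * phi u)).
  have mI : measurable (`]0, t[%classic : set (measurableTypeR R)).
    exact: measurable_itv.
  move=> t0; rewrite {1}yE /volterra mulrA -(RintegralZl (_ * _) mI (iJ t)).
  congr (_ + _); apply: eq_Rintegral => s; rewrite inE/= in_itv/= => st.
  by rewrite subr0 KgE.
exists (fun t => t `^ (- (1 - beta)) * y t).
apply: (RL_solution_of_volterra hbeta cy (y_le0 0 (lexx _)) phi_cont iphi iJ yV).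
by [].
Qed.
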